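(* Let $A$ be a Banach algebra, let $a,b\in A$, and suppose that $\sigma(a)$ is finite. Then $d(a,b)=0$ if and only if the following two conditions hold: (i) $\sigma(a)=\sigma(b)$; (ii) $p(\lambda,a)=p(\lambda,b)$ for each $\lambda\in\sigma(a)$.
   Context: Banach algebras are over $\mathbb{C}$ and have a unit $1$; $\sigma(x)$ is the spectrum of $x\in A$. For $a,b\in A$ let $C_{a,b}:A\to A$ be the bounded operator $C_{a,b}x=ax-xb$, put $\rho(a,b)=\limsup_{n\to\infty}\|C_{a,b}^n1\|^{1/n}$ and $d(a,b)=\max\{\rho(a,b),\rho(b,a)\}$. For an isolated point $\lambda$ of $\sigma(a)$, $p(\lambda,a)=\frac{1}{2\pi i}\int_{\Gamma}(\mu-a)^{-1}\,d\mu$ is the Riesz projection associated with $a$ and $\lambda$, where $\Gamma$ is a small positively oriented circle around $\lambda$ isolating $\lambda$ from the rest of $\sigma(a)$. *)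

(* Defs.v *)
From Stdlib Require Import Reals List ClassicalEpsilon.
From Coquelicot Require Import Coquelicot.
Open Scope R_scope.

(** Unital complex Banach algebras, extending Coquelicot's hierarchy: a complete
    normed module over [C] with a ring structure on its additive group.  The
    norm is submultiplicative; neither [norm one = 1] nor [one <> zero] is
    imposed. *)
Module BanachAlgebra.

Record mixin_of (V : CompleteNormedModule C_AbsRing) (r : Ring.mixin_of V) :=
  Mixin {
    ax1 : forall (l : C) (x y : V),
        Ring.mult V r (scal l x) y = scal l (Ring.mult V r x y);
    ax2 : forall (l : C) (x y : V),
        Ring.mult V r x (scal l y) = scal l (Ring.mult V r x y);
    ax3 : forall x y : V, norm (Ring.mult V r x y) <= norm x * norm y
  }.

Record class_of (T : Type) := Class {
  base : CompleteNormedModule.class_of C_AbsRing T;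
  ring : Ring.mixin_of (CompleteNormedModule.Pack C_AbsRing T base T);
  mixin : mixin_of (CompleteNormedModule.Pack C_AbsRing T base T) ring
}.

Record type := Pack { sort : Type; class : class_of sort }.

Section Structures.

Context (A : type).

Definition CompleteNormedModule : CompleteNormedModule C_AbsRing :=
  CompleteNormedModule.Pack C_AbsRing (sort A) (base _ (class A)) (sort A).
Definition CompleteSpace : CompleteSpace :=
  CompleteSpace.Pack (sort A)
    (CompleteNormedModule.base2 C_AbsRing (sort A) (base _ (class A))) (sort A).
Definition NormedModule : NormedModule C_AbsRing :=
  NormedModule.Pack C_AbsRing (sort A) (base _ (class A)) (sort A).
Definition NormedModuleAux : NormedModuleAux C_AbsRing :=
  NormedModuleAux.Pack C_AbsRing (sort A) (base _ (class A)) (sort A).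
Definition ModuleSpace : ModuleSpace C_AbsRing :=
  ModuleSpace.Pack C_AbsRing (sort A) (base _ (class A)) (sort A).
Definition UniformSpace : UniformSpace :=
  UniformSpace.Pack (sort A) (base _ (class A)) (sort A).
Definition AbelianGroup : AbelianGroup :=
  AbelianGroup.Pack (sort A) (base _ (class A)) (sort A).
Definition AbelianMonoid : AbelianMonoid :=
  AbelianMonoid.Pack (sort A) (base _ (class A)) (sort A).
Definition Ring : Ring :=
  Ring.Pack (sort A)
    (Ring.Class (sort A)
       (CompleteNormedModule.base C_AbsRing (sort A) (base _ (class A)))
       (ring _ (class A)))
    (sort A).

End Structures.

Module Exports.

Coercion sort : type >-> Sortclass.
Coercion CompleteNormedModule : type >-> CompleteNormedModule.type.
Canonical CompleteNormedModule.
Coercion CompleteSpace : type >-> CompleteSpace.type.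
Canonical CompleteSpace.
Coercion NormedModule : type >-> NormedModule.type.
Canonical NormedModule.
Coercion NormedModuleAux : type >-> NormedModuleAux.type.
Canonical NormedModuleAux.
Coercion ModuleSpace : type >-> ModuleSpace.type.
Canonical ModuleSpace.
Coercion UniformSpace : type >-> UniformSpace.type.
Canonical UniformSpace.
Coercion AbelianGroup : type >-> AbelianGroup.type.
Canonical AbelianGroup.
Coercion AbelianMonoid : type >-> AbelianMonoid.type.
Canonical AbelianMonoid.
Coercion Ring : type >-> Ring.type.
Canonical Ring.
Notation BanachAlgebra := type.

End Exports.

End BanachAlgebra.

Export BanachAlgebra.Exports.

Section BanachAlgebraTheory.

Context (A : BanachAlgebra).

Lemma alg_scal_mult_l (l : C) (x y : A) : mult (scal l x) y = scal l (mult x y).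
Proof. exact (BanachAlgebra.ax1 _ _ (BanachAlgebra.mixin _ (BanachAlgebra.class A)) l x y). Qed.

Lemma alg_scal_mult_r (l : C) (x y : A) : mult x (scal l y) = scal l (mult x y).
Proof. exact (BanachAlgebra.ax2 _ _ (BanachAlgebra.mixin _ (BanachAlgebra.class A)) l x y). Qed.

Lemma alg_norm_mult (x y : A) : norm (mult x y) <= norm x * norm y.
Proof. exact (BanachAlgebra.ax3 _ _ (BanachAlgebra.mixin _ (BanachAlgebra.class A)) x y). Qed.

End BanachAlgebraTheory.

(** Restriction of scalars from [C] to [R], with the same carrier, norm and
    uniform structure: [RInt] takes its values in normed modules over [R]. *)
Section Realify.

Context (V : CompleteNormedModule C_AbsRing).

Definition realify_scal (l : R) (x : V) : V := scal (RtoC l) x.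

Lemma realify_ax1 (x y : R) (u : V) :
  realify_scal x (realify_scal y u) = realify_scal (mult x y) u.
Proof.
unfold realify_scal; rewrite scal_assoc; f_equal.
symmetry; exact (RtoC_mult x y).
Qed.

Lemma realify_ax2 (u : V) : realify_scal one u = u.
Proof. exact (scal_one u). Qed.

Lemma realify_ax3 (x : R) (u v : V) :
  realify_scal x (plus u v) = plus (realify_scal x u) (realify_scal x v).
Proof. exact (scal_distr_l (RtoC x) u v). Qed.

Lemma realify_ax4 (x y : R) (u : V) :
  realify_scal (plus x y) u = plus (realify_scal x u) (realify_scal y u).
Proof.
transitivity (scal (plus (RtoC x) (RtoC y) : C_AbsRing) u).
- unfold realify_scal; f_equal; exact (RtoC_plus x y).
- exact (scal_distr_r (RtoC x : C_AbsRing) (RtoC y) u).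
Qed.

Definition realify_ModuleSpace_mixin : ModuleSpace.mixin_of R_Ring V :=
  ModuleSpace.Mixin R_Ring V realify_scal
    realify_ax1 realify_ax2 realify_ax3 realify_ax4.

Definition realify_NormedModuleAux : NormedModuleAux R_AbsRing :=
  NormedModuleAux.Pack R_AbsRing V
    (NormedModuleAux.Class R_AbsRing V
       (ModuleSpace.Class R_Ring V (AbelianGroup.class V)
          realify_ModuleSpace_mixin)
       (UniformSpace.class V))
    V.

Lemma realify_norm_scal (l : R) (x : V) :
  norm (realify_scal l x) <= abs l * norm x.
Proof.
unfold realify_scal; eapply Rle_trans; [exact (@norm_scal C_AbsRing V (RtoC l) x)|].
apply Rmult_le_compat_r; [apply norm_ge_0|].
right; exact (Cmod_R l).
Qed.

Definition realify_NormedModule_mixin :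
  NormedModule.mixin_of R_AbsRing realify_NormedModuleAux :=
  NormedModule.Mixin R_AbsRing realify_NormedModuleAux
    (fun x : V => norm x) (@norm_factor C_AbsRing V)
    (@norm_triangle C_AbsRing V) realify_norm_scal
    (@norm_compat1 C_AbsRing V) (@norm_compat2 C_AbsRing V)
    (@norm_eq_zero C_AbsRing V).

Definition realify : CompleteNormedModule R_AbsRing :=
  CompleteNormedModule.Pack R_AbsRing V
    (CompleteNormedModule.Class R_AbsRing V
       (NormedModule.Class R_AbsRing V
          (NormedModuleAux.class R_AbsRing realify_NormedModuleAux)
          realify_NormedModule_mixin)
       (CompleteSpace.class V))
    V.

End Realify.

Section Spectrum.

Context {A : BanachAlgebra}.

Definition is_inverse (x y : A) : Prop := mult x y = one /\ mult y x = one.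

Definition invertible (x : A) : Prop := exists y : A, is_inverse x y.

(** [iota P] is the unique element satisfying [P]; junk if [x] is not
    invertible. *)
Definition inv (x : A) : A := iota (is_inverse x).

Definition shift (a : A) (mu : C) : A := minus (scal mu (one : A)) a.

Definition spectrum (a : A) (mu : C) : Prop := ~ invertible (shift a mu).

Definition finite_set (S : C -> Prop) : Prop :=
  exists l : list C, forall z : C, S z -> In z l.

Definition resolvent (a : A) (mu : C) : A := inv (shift a mu).

End Spectrum.

Section Rho.

Context {A : BanachAlgebra}.

Definition Cop (a b x : A) : A := minus (mult a x) (mult x b).

(** [Rpower 0 y] is not [0] in the standard library, hence the case split.
    The value at [n = 0] is irrelevant to a limit superior. *)
Definition nth_root (n : nat) (x : R) : R :=
  if Req_EM_T x 0 then 0 else Rpower x (/ INR n).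

Definition rho (a b : A) : Rbar :=
  LimSup_seq (fun n => nth_root n (norm (Nat.iter n (Cop a b) one))).

Definition Rbar_max (x y : Rbar) : Rbar := if Rbar_le_dec x y then y else x.

Definition qdist (a b : A) : Rbar := Rbar_max (rho a b) (rho b a).

End Rho.

Section Riesz.

Context {A : BanachAlgebra}.

Definition expi (t : R) : C := (cos t, sin t).

(** The integral of [f] over the circle with centre [c] and radius [r],
    parametrised by [t |-> c + r e^(it)], [0 <= t <= 2 pi]. *)
Definition circle_int (f : C -> A) (c : C) (r : R) : A :=
  RInt (V := realify A)
    (fun t => scal (Ci * r * expi t)%C (f (c + r * expi t)%C)) 0 (2 * PI).

Definition isolating_radius (a : A) (lambda : C) (r : R) : Prop :=
  0 < r /\
  forall mu : C, spectrum a mu -> Cmod (mu - lambda)%C <= r -> mu = lambda.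

(** The radius is an arbitrary isolating one; by Cauchy's theorem the integral
    does not depend on it.  Junk if no isolating radius exists. *)
Definition riesz_proj (lambda : C) (a : A) : A :=
  scal (/ (2 * PI * Ci))%C
    (circle_int (resolvent a) lambda
       (epsilon (inhabits 1) (isolating_radius a lambda))).

End Riesz.

(* Main.v *)
Require Import Defs.
From Stdlib Require Import Reals Lra Lia List Classical ClassicalEpsilon.
From Stdlib Require Ncring Ncring_tac.
From Coquelicot Require Import Coquelicot.

(** Write $C = C_{a,b}$, and call a sequence small when the $n$-th roots of
    its norms tend to $0$. The condition $d(a,b)=0$ says that $C_{a,b}^n1$ and
    $C_{b,a}^n1$ are small ([qdist_zero_iff]), and the theorem becomes a statement
    about small sequences in the algebra.

    For an isolated spectral point $\lambda$ of $a$ put $c = a-\lambda$. All that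
    is used of $p = p(\lambda,a)$ is the following ([riesz_splitting]): it is an
    idempotent in the bicommutant of $c$, the sequence $c^np$ is small, and
    $1-p = cy$ for some $y$ in the bicommutant.

    Suppose that $d(a,b)=0$. The series
    $\sum_n(-1)^n(\mu-a)^{-n-1}C_{a,b}^n1$ is a left inverse of $\mu-b$ whenever
    $\mu\notin\sigma(a)$, and $C_{b,a}$ supplies a right inverse, so that the
    spectra agree ([spectrum_incl]). Let $q=p(\lambda,b)$ and $d=b-\lambda$. The
    binomial expansion of $c^n$ in left and right multiplications shows that
    $c^nq$ is small, whence $(1-p)q = (1-p)y^nc^nq$ is $0$; symmetrically
    $p(1-q)=0$, and $p=q$ ([splitting_unique]).

    Conversely let the spectra and the projections agree. The same binomial
    argument shows that $C^n1\cdot p_\lambda$ is small for each $\lambda$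
    ([superexp_on_projection]). It remains to know that
    $q=\prod_\lambda(1-p_\lambda)$ vanishes. But $a$ has no spectrum on the range
    of $q$: the element $aq$ is quasinilpotent and yet invertible there, which
    forces $q=0$ ([idem_without_spectrum_zero], [superexp_of_projections]).

    The splitting itself, and the fact that an element with spectrum inside
    $\{0\}$ is quasinilpotent, are obtained without integral theorems. The
    Riemann sum of the Riesz integral at the $N$-th roots of unity is exactly
    $E_N(r) = (1-(c/r)^N)^{-1}$, where $r$ is the radius of the circle
    ([pow_order_mul_moment]). Partial fractions give $p(r)p(s)=p(s)$ for $s<r$
    in the limit; by continuity in the radius each $p(r)$ is idempotent, and
    since two nested idempotents at distance less than $1$ coincide, $p(r)$ does
    not depend on $r$ ([projection_radius]). Smallness of $c^np$ follows by
    letting $r$ tend to $0$ in $\|c^np(r)\|\le M_rr^{n+1}$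
    ([projection_quasinilpotent]). *)

(** * Calculations in a Banach algebra *)

Declare Scope alg_scope.
Delimit Scope alg_scope with A.
Bind Scope alg_scope with BanachAlgebra.sort.

(** The operations of the hierarchy restated with the algebra itself as their
    type: the same sum is otherwise elaborated in several convertible forms,
    according to the structure through which its arguments are seen. *)
Section Operations.

Context {A : BanachAlgebra}.

Definition alg_zero : A := zero.
Definition alg_one : A := one.
Definition alg_add (x y : A) : A := plus x y.
Definition alg_opp (x : A) : A := opp x.
Definition alg_sub (x y : A) : A := minus x y.
Definition alg_mul (x y : A) : A := mult x y.
Definition alg_scal (k : C) (x : A) : A := scal k x.
Definition alg_pow (x : A) (n : nat) : A := Nat.iter n (alg_mul x) alg_one.
Definition alg_norm (x : A) : R := norm x.

End Operations.

Notation "0" := alg_zero : alg_scope.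
Notation "1" := alg_one : alg_scope.
Infix "+" := alg_add : alg_scope.
Notation "- x" := (alg_opp x) : alg_scope.
Infix "-" := alg_sub : alg_scope.
Infix "*" := alg_mul : alg_scope.
Notation "k *: x" := (alg_scal k x) (at level 40, left associativity) : alg_scope.
Infix "^" := alg_pow : alg_scope.
Notation "⟦ x ⟧" := (alg_norm x%A) (at level 0, format "⟦ x ⟧") : R_scope.

#[export] Instance algebra_ops {A : BanachAlgebra} :
  @Ncring.Ring_ops A alg_zero alg_one alg_add alg_mul alg_sub alg_opp eq := {}.

#[export] Instance algebra_ring {A : BanachAlgebra} :
  Ncring.Ring (Ro := @algebra_ops A).
Proof.
constructor.
- exact RelationClasses.eq_equivalence.
- intros x y -> z t ->; reflexivity.
- intros x y -> z t ->; reflexivity.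
- intros x y -> z t ->; reflexivity.
- intros x y ->; reflexivity.
- exact (@plus_zero_l A).
- exact (@plus_comm A).
- exact (@plus_assoc A).
- exact (@mult_one_l A).
- exact (@mult_one_r A).
- exact (@mult_assoc A).
- exact (@mult_distr_r A).
- intros x y z; exact (@mult_distr_l A z x y).
- reflexivity.
- exact (@plus_opp_r A).
Qed.

Ltac nc_ring := Ncring_tac.non_commutative_ring.

Section Algebra.

Context {A : BanachAlgebra}.
Implicit Types x y z q : A.

Lemma mul_1_l x : (1 * x = x)%A.
Proof. nc_ring. Qed.

Lemma mul_1_r x : (x * 1 = x)%A.
Proof. nc_ring. Qed.

Lemma mul_assoc x y z : (x * (y * z) = x * y * z)%A.
Proof. nc_ring. Qed.

Lemma scal_mul_l (k : C) x y : ((k *: x) * y = k *: (x * y))%A.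
Proof. apply alg_scal_mult_l. Qed.

Lemma scal_mul_r (k : C) x y : (x * (k *: y) = k *: (x * y))%A.
Proof. apply alg_scal_mult_r. Qed.

Lemma scal_scal (k l : C) x : (k *: (l *: x) = (k * l)%C *: x)%A.
Proof. exact (@scal_assoc C_AbsRing A k l x). Qed.

Lemma scal_1 x : (RtoC 1 *: x = x)%A.
Proof. exact (@scal_one C_AbsRing A x). Qed.

Lemma scal_0_r (k : C) : (k *: (0 : A) = 0)%A.
Proof. exact (@scal_zero_r C_AbsRing A k). Qed.

Lemma scal_sub (k : C) x y : (k *: (x - y) = k *: x - k *: y)%A.
Proof. exact (@scal_minus_distr_l C_AbsRing A k x y). Qed.

Lemma scal_add (k : C) x y : (k *: (x + y) = k *: x + k *: y)%A.
Proof. exact (@scal_distr_l C_AbsRing A k x y). Qed.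

Lemma sub_scal (k l : C) x : ((k - l)%C *: x = k *: x - l *: x)%A.
Proof. exact (@scal_minus_distr_r C_AbsRing A k l x). Qed.

Lemma add_scal (k l : C) x : ((k + l)%C *: x = k *: x + l *: x)%A.
Proof. exact (@scal_distr_r C_AbsRing A k l x). Qed.

Lemma norm_nonneg x : 0 <= ⟦x⟧.
Proof. exact (@norm_ge_0 C_AbsRing A x). Qed.

Lemma norm_0 : ⟦(0 : A)⟧ = 0.
Proof. exact (@norm_zero C_AbsRing A). Qed.

Lemma norm_0_eq x : ⟦x⟧ <= 0 -> x = 0%A.
Proof.
intros H; apply (@norm_eq_zero C_AbsRing A), Rle_antisym; [exact H|].
apply norm_nonneg.
Qed.

Lemma norm_add x y : ⟦x + y⟧ <= ⟦x⟧ + ⟦y⟧.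
Proof. exact (@norm_triangle C_AbsRing A x y). Qed.

Lemma norm_opp_eq x : ⟦- x⟧ = ⟦x⟧.
Proof. exact (@norm_opp C_AbsRing A x). Qed.

Lemma norm_sub x y : ⟦x - y⟧ <= ⟦x⟧ + ⟦y⟧.
Proof.
replace (x - y)%A with (x + - y)%A by nc_ring.
rewrite <- (norm_opp_eq y); apply norm_add.
Qed.

Lemma norm_sub_sym x y : ⟦x - y⟧ = ⟦y - x⟧.
Proof. rewrite <- norm_opp_eq; f_equal; nc_ring. Qed.

Lemma norm_scal_le (k : C) x : ⟦k *: x⟧ <= Cmod k * ⟦x⟧.
Proof. exact (@norm_scal C_AbsRing A k x). Qed.

Lemma norm_mul x y : ⟦x * y⟧ <= ⟦x⟧ * ⟦y⟧.
Proof. apply alg_norm_mult. Qed.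

Lemma norm_mul_bound x y (u v : R) : ⟦x⟧ <= u -> ⟦y⟧ <= v -> ⟦x * y⟧ <= u * v.
Proof.
intros Hx Hy; eapply Rle_trans; [apply norm_mul|].
apply Rmult_le_compat; auto; apply norm_nonneg.
Qed.

Lemma norm_pow x (n : nat) : ⟦x ^ n⟧ <= ⟦x⟧ ^ n * ⟦1 : A⟧.
Proof.
induction n as [|n IH]; simpl; [lra|].
rewrite Rmult_assoc; apply norm_mul_bound; [lra | exact IH].
Qed.

(** Applied to a small idempotent [x], where $\|x\| = \|x^2\| \le \|x\|^2$. *)
Lemma norm_small_zero x : ⟦x⟧ < 1 -> ⟦x⟧ <= ⟦x⟧ * ⟦x⟧ -> x = 0%A.
Proof. intros H1 H2; apply norm_0_eq; pose proof (norm_nonneg x); nra. Qed.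

Lemma sub_0_eq x y : (x - y = 0)%A -> x = y.
Proof.
intros H; transitivity (x - y + y)%A; [nc_ring|]; rewrite H; nc_ring.
Qed.

Definition commute x y : Prop := (x * y = y * x)%A.

Lemma commute_sym x y : commute x y -> commute y x.
Proof. intros H; symmetry; exact H. Qed.

Lemma commute_1 x : commute x 1.
Proof. unfold commute; nc_ring. Qed.

Lemma commute_mul x y z : commute x y -> commute x z -> commute x (y * z).
Proof.
unfold commute; intros Hy Hz.
now rewrite mul_assoc, Hy, <- mul_assoc, Hz, mul_assoc.
Qed.

Lemma commute_sub x y z : commute x y -> commute x z -> commute x (y - z).
Proof.
unfold commute; intros Hy Hz.
transitivity (x * y - x * z)%A; [nc_ring | rewrite Hy, Hz; nc_ring].
Qed.

Lemma commute_scal x y (k : C) : commute x y -> commute x (k *: y).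
Proof. unfold commute; intros H; now rewrite scal_mul_l, scal_mul_r, H. Qed.

Lemma pow_S x (n : nat) : (x ^ S n = x * x ^ n)%A.
Proof. reflexivity. Qed.

Lemma commute_pow x y (n : nat) : commute x y -> commute x (y ^ n).
Proof.
intros H; induction n as [|n IH]; [apply commute_1 | now apply commute_mul].
Qed.

Lemma pow_S_r x (n : nat) : (x ^ S n = x ^ n * x)%A.
Proof. rewrite pow_S; now apply commute_pow. Qed.

Lemma pow_mul x y (n : nat) : commute x y -> ((x * y) ^ n = x ^ n * y ^ n)%A.
Proof.
intros H; induction n as [|n IH]; simpl; [nc_ring|].
assert (E : (y * x ^ n = x ^ n * y)%A) by apply commute_pow, commute_sym, H.
transitivity (x * (y * x ^ n) * y ^ n)%A; [rewrite IH; nc_ring|].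
rewrite E; nc_ring.
Qed.

(** Stated for positive exponents because $q^0 = 1$. *)
Lemma pow_idem q (n : nat) : (q * q = q)%A -> (q ^ S n = q)%A.
Proof.
intros H; induction n as [|n IH]; [simpl; nc_ring|].
now rewrite pow_S, IH.
Qed.

(** * Superexponential decay *)

(** The $n$-th roots of the norms tend to $0$; the constant absorbs the first
    terms, so that the estimate holds for all [n] and survives convolution. *)
Definition superexp (x : nat -> A) : Prop :=
  forall eps : R, 0 < eps ->
  exists K : R, 0 <= K /\ forall n, ⟦x n⟧ <= K * eps ^ n.

Lemma superexp_ext (x y : nat -> A) :
  (forall n, x n = y n) -> superexp x -> superexp y.
Proof.
intros E H eps He; destruct (H eps He) as (K & HK & B).
exists K; split; [exact HK|]; intros n; rewrite <- E; apply B.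
Qed.

Lemma superexp_zero : superexp (fun _ => 0%A).
Proof.
intros eps He; exists 0; split; [lra|]; intros n.
rewrite norm_0; lra.
Qed.

Lemma superexp_plus (x y : nat -> A) :
  superexp x -> superexp y -> superexp (fun n => (x n + y n)%A).
Proof.
intros Hx Hy eps He.
destruct (Hx eps He) as (K & HK & B); destruct (Hy eps He) as (L & HL & D).
exists (K + L); split; [lra|]; intros n.
eapply Rle_trans; [apply norm_add|].
specialize (B n); specialize (D n); lra.
Qed.

Lemma superexp_mul_r (x : nat -> A) (y : A) :
  superexp x -> superexp (fun n => (x n * y)%A).
Proof.
intros Hx eps He; destruct (Hx eps He) as (K & HK & B).
exists (K * ⟦y⟧); split; [apply Rmult_le_pos; [lra | apply norm_nonneg]|].
intros n; replace (K * ⟦y⟧ * eps ^ n) with (K * eps ^ n * ⟦y⟧) by ring.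
apply norm_mul_bound; [apply B | lra].
Qed.

Lemma superexp_mul_l (x : nat -> A) (y : A) :
  superexp x -> superexp (fun n => (y * x n)%A).
Proof.
intros Hx eps He; destruct (Hx eps He) as (K & HK & B).
exists (⟦y⟧ * K); split; [apply Rmult_le_pos; [apply norm_nonneg | lra]|].
intros n; rewrite Rmult_assoc; apply norm_mul_bound; [lra | apply B].
Qed.

Lemma superexp_beats_pow (x : nat -> A) (y : A) :
  superexp x -> is_lim_seq (fun n => ⟦x n⟧ * ⟦y ^ n⟧) 0.
Proof.
intros Hx; pose proof (norm_nonneg y) as HM; set (M := ⟦y⟧) in *.
destruct (Hx (/ (2 * (M + 1)))) as (K & HK & D).
{ apply Rinv_0_lt_compat; lra. }
assert (HK1 : 0 <= K * ⟦1 : A⟧) by (apply Rmult_le_pos; [lra | apply norm_nonneg]).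
apply (is_lim_seq_le_le (fun _ => 0) _ (fun n => K * ⟦1 : A⟧ * (/ 2) ^ n) 0).
2: apply is_lim_seq_const.
2: { replace (Finite 0) with (Finite (K * ⟦1 : A⟧ * 0)) by (f_equal; ring).
     apply (is_lim_seq_scal_l (fun n => (/ 2) ^ n) (K * ⟦1 : A⟧) 0).
     apply is_lim_seq_geom; rewrite Rabs_pos_eq; lra. }
intros n; split; [apply Rmult_le_pos; apply norm_nonneg|].
eapply Rle_trans.
{ apply Rmult_le_compat; [apply norm_nonneg | apply norm_nonneg | apply D | apply norm_pow]. }
fold M; replace (K * (/ (2 * (M + 1))) ^ n * (M ^ n * ⟦1 : A⟧))
  with (K * ⟦1 : A⟧ * (/ (2 * (M + 1)) * M) ^ n) by (rewrite Rpow_mult_distr; ring).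
apply Rmult_le_compat_l; [exact HK1|].
apply pow_incr; split.
- apply Rmult_le_pos; [left; apply Rinv_0_lt_compat; lra | exact HM].
- apply Rmult_le_reg_l with (2 * (M + 1)); [lra|].
  replace (2 * (M + 1) * (/ (2 * (M + 1)) * M)) with M by (field; lra); lra.
Qed.

Lemma superexp_small (x : nat -> A) (y : A) :
  superexp x -> exists n, ⟦x n⟧ * ⟦y ^ n⟧ < 1.
Proof.
intros Hx; pose proof (superexp_beats_pow x y Hx) as L.
apply is_lim_seq_spec in L; destruct (L (mkposreal 1 Rlt_0_1)) as [N HN].
exists N; specialize (HN N (le_n N)); simpl in HN.
rewrite Rminus_0_r in HN; eapply Rle_lt_trans; [apply Rle_abs | exact HN].
Qed.

Lemma superexp_pow_bound_zero (x : nat -> A) (y z : A) :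
  superexp x -> (forall n, ⟦z⟧ <= ⟦x n⟧ * ⟦y ^ n⟧) -> z = 0%A.
Proof.
intros Hx Hz; apply norm_0_eq.
exact (is_lim_seq_le (fun _ => ⟦z⟧) _ ⟦z⟧ 0 Hz (is_lim_seq_const _)
         (superexp_beats_pow x y Hx)).
Qed.

Lemma superexp_pow_r_zero (x : nat -> A) (y z : A) :
  superexp x -> (forall n, z = (x n * y ^ n)%A) -> z = 0%A.
Proof.
intros Hx Hz; apply (superexp_pow_bound_zero x y z Hx); intros n.
rewrite (Hz n) at 1; apply norm_mul.
Qed.

Lemma superexp_pow_l_zero (x : nat -> A) (y z : A) :
  superexp x -> (forall n, z = (y ^ n * x n)%A) -> z = 0%A.
Proof.
intros Hx Hz; apply (superexp_pow_bound_zero x y z Hx); intros n.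
rewrite (Hz n) at 1; rewrite Rmult_comm; apply norm_mul.
Qed.

(** The binomial theorem in disguise: if each step in [n] splits a term into
    its neighbours in [i] and [j], then the $2^n$ descendants of level [0] all
    carry the factor $\varepsilon^n$, and $(2\varepsilon)^n$ is still as small
    as desired. *)
Lemma superexp_binomial (w : nat -> nat -> nat -> A) :
  (forall eps, 0 < eps -> exists K, 0 <= K /\
     forall i j, ⟦w O i j⟧ <= K * eps ^ (i + j)) ->
  (forall n i j, ⟦w (S n) i j⟧ <= ⟦w n (S i) j⟧ + ⟦w n i (S j)⟧) ->
  superexp (fun n => w n O O).
Proof.
intros H0 HS eps He.
destruct (H0 (eps / 2)) as (K & HK & B); [lra|].
exists K; split; [exact HK|].
assert (G : forall n i j, ⟦w n i j⟧ <= K * (eps / 2) ^ (i + j) * eps ^ n).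
{ induction n as [|n IH]; intros i j.
  - simpl; rewrite Rmult_1_r; apply B.
  - eapply Rle_trans; [apply HS|].
    pose proof (IH (S i) j) as I1; pose proof (IH i (S j)) as I2.
    rewrite Nat.add_succ_r in I2; simpl in I1, I2 |- *; lra. }
intros n; specialize (G n O O); simpl in G; lra.
Qed.

End Algebra.

(** * The radius of the commutator iterates *)

Section Radius.

Context {A : BanachAlgebra}.

Lemma nth_root_nonneg (n : nat) (x : R) : 0 <= nth_root n x.
Proof.
unfold nth_root; destruct (Req_EM_T x 0); [lra|].
left; apply exp_pos.
Qed.

Lemma nth_root_pow (n : nat) (x : R) : 0 <= x -> nth_root (S n) x ^ S n = x.
Proof.
intros Hx; unfold nth_root; destruct (Req_EM_T x 0) as [->|Hx0]; [simpl; ring|].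
rewrite <- Rpower_pow by apply exp_pos.
rewrite Rpower_mult, Rinv_l by (apply not_0_INR; lia).
apply Rpower_1; lra.
Qed.

Lemma nth_root_lt (n : nat) (x eps : R) :
  0 <= x -> 0 < eps -> x < eps ^ S n -> nth_root (S n) x < eps.
Proof.
intros Hx He H; apply Rnot_le_lt; intros C.
apply (Rlt_not_le _ _ H); rewrite <- (nth_root_pow n x Hx).
apply pow_incr; lra.
Qed.

Lemma INR_le_pow2 (n : nat) : INR n <= 2 ^ n.
Proof.
induction n as [|n IH]; [simpl; lra|].
rewrite S_INR; simpl; pose proof (pow_R1_Rle 2 n); lra.
Qed.

Definition iterates (a b : A) (n : nat) : A := Nat.iter n (Cop a b) one.

Lemma rho_nonneg (a b : A) : Rbar_le 0 (rho a b).
Proof.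
unfold rho; set (u := fun n => _).
assert (H : is_LimSup_seq u (LimSup_seq u)) by exact (proj2_sig (ex_LimSup_seq u)).
destruct (LimSup_seq u) as [l| |]; simpl in *; trivial.
- apply Rnot_lt_le; intros Hl.
  destruct (H (mkposreal (- l) ltac:(lra))) as [_ [N HN]].
  specialize (HN N (le_n N)); simpl in HN.
  pose proof (nth_root_nonneg N (norm (Nat.iter N (Cop a b) one))).
  unfold u in HN; lra.
- destruct (H 0) as [N HN]; specialize (HN N (le_n N)).
  pose proof (nth_root_nonneg N (norm (Nat.iter N (Cop a b) one))).
  unfold u in HN; lra.
Qed.

(** The finitely many exceptional terms go into the constant. *)
Lemma eventually_superexp (x : nat -> A) :
  (forall eps, 0 < eps -> exists N, forall n, (N <= n)%nat -> ⟦x n⟧ <= eps ^ n) ->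
  superexp x.
Proof.
intros H eps He; destruct (H eps He) as [N HN]; clear H.
assert (F : forall N, exists K, 0 <= K /\ forall n, (n < N)%nat -> ⟦x n⟧ <= K * eps ^ n).
{ clear N HN; induction N as [|N (K & HK & B)].
  - exists 0; split; [lra|]; intros n Hn; lia.
  - assert (P : 0 < eps ^ N) by now apply pow_lt.
    assert (Q : 0 <= ⟦x N⟧ / eps ^ N).
    { apply Rmult_le_pos; [apply norm_nonneg | left; now apply Rinv_0_lt_compat]. }
    exists (K + ⟦x N⟧ / eps ^ N); split; [lra|].
    intros n Hn; assert (P' : 0 < eps ^ n) by now apply pow_lt.
    destruct (Nat.eq_dec n N) as [->|Hne].
    + rewrite Rmult_plus_distr_r.
      replace (⟦x N⟧ / eps ^ N * eps ^ N) with (⟦x N⟧) by (field; lra).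
      assert (0 <= K * eps ^ N) by (apply Rmult_le_pos; lra); lra.
    + eapply Rle_trans; [apply B; lia|]; apply Rmult_le_compat_r; lra. }
destruct (F N) as (K & HK & B); exists (K + 1); split; [lra|]; intros n.
assert (P : 0 < eps ^ n) by now apply pow_lt.
destruct (Nat.lt_ge_cases n N) as [Hn|Hn].
- specialize (B n Hn); lra.
- specialize (HN n Hn); assert (0 <= K * eps ^ n) by (apply Rmult_le_pos; lra); lra.
Qed.

Lemma rho_zero_iff (a b : A) : rho a b = Finite 0 <-> superexp (iterates a b).
Proof.
unfold rho; set (u := fun n => _); split.
- intros H0; assert (H : is_LimSup_seq u 0).
  { rewrite <- H0; exact (proj2_sig (ex_LimSup_seq u)). }
  apply eventually_superexp; intros eps He.
  destruct (H (mkposreal eps He)) as [_ [N HN]]; simpl in HN.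
  exists (S N); intros n Hn; destruct n as [|n]; [lia|].
  rewrite <- (nth_root_pow n ⟦iterates a b (S n)⟧) by apply norm_nonneg.
  specialize (HN (S n) ltac:(lia)); rewrite Rplus_0_l in HN.
  apply pow_incr; split; [apply nth_root_nonneg | left; exact HN].
- intros H; apply is_LimSup_seq_unique; intros [eps He]; simpl; split.
  + intros N; exists N; split; [lia|].
    unfold u; pose proof (nth_root_nonneg N (norm (Nat.iter N (Cop a b) one))); lra.
  + destruct (H (eps / 2)) as (K & HK & B); [lra|].
    (* The factor $2^n$ gained on $\varepsilon^n$ absorbs the constant. *)
    destruct (nfloor_ex K HK) as [N [_ HN]].
    exists (S N); intros n Hn; destruct n as [|n]; [lia|].
    unfold u; rewrite Rplus_0_l; apply nth_root_lt; [apply norm_nonneg | exact He|].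
    apply (Rle_lt_trans _ _ _ (B (S n))).
    assert (P : 0 < (eps / 2) ^ S n) by (apply pow_lt; lra).
    replace (eps ^ S n) with (2 ^ S n * (eps / 2) ^ S n)
      by (rewrite <- Rpow_mult_distr; f_equal; field).
    apply Rmult_lt_compat_r; [exact P|].
    apply Rlt_le_trans with (INR (S n)).
    * eapply Rlt_le_trans; [exact HN|]; rewrite <- S_INR; apply le_INR; lia.
    * apply INR_le_pow2.
Qed.
End Radius.

(** * Limits *)

Section Limits.

Context {A : BanachAlgebra}.
Implicit Types (u v : nat -> A) (l m x : A).

Definition conv u l : Prop := is_lim_seq (fun n => ⟦u n - l⟧) 0.

Lemma conv_of_bound u l (v : nat -> R) :
  (forall n, ⟦u n - l⟧ <= v n) -> is_lim_seq v 0 -> conv u l.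
Proof.
intros B Hv; unfold conv.
apply (is_lim_seq_le_le (fun _ => 0) _ v 0); trivial; [|apply is_lim_seq_const].
intros n; split; [apply norm_nonneg | apply B].
Qed.

Lemma conv_ext u v l : (forall n, u n = v n) -> conv u l -> conv v l.
Proof. intros E; apply is_lim_seq_ext; intros n; now rewrite E. Qed.

Lemma conv_const l : conv (fun _ => l) l.
Proof.
unfold conv; apply is_lim_seq_ext with (fun _ => 0); [|apply is_lim_seq_const].
intros _; replace (l - l)%A with (0 : A)%A by nc_ring.
symmetry; apply norm_0.
Qed.

Lemma conv_sub u v l m :
  conv u l -> conv v m -> conv (fun n => u n - v n)%A (l - m).
Proof.
intros Hu Hv.
apply conv_of_bound with (fun n => ⟦u n - l⟧ + ⟦v n - m⟧).
- intros n; replace (u n - v n - (l - m))%A with (u n - l - (v n - m))%A by nc_ring.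
  apply norm_sub.
- replace 0 with (0 + 0) by ring; exact (is_lim_seq_plus' _ _ 0 0 Hu Hv).
Qed.

Lemma conv_mul_l x u l : conv u l -> conv (fun n => x * u n)%A (x * l).
Proof.
intros Hu; apply conv_of_bound with (fun n => ⟦x⟧ * ⟦u n - l⟧).
- intros n; replace (x * u n - x * l)%A with (x * (u n - l))%A by nc_ring.
  apply norm_mul.
- replace 0 with (⟦x⟧ * 0) by ring; exact (is_lim_seq_scal_l _ ⟦x⟧ 0 Hu).
Qed.

Lemma conv_mul_r x u l : conv u l -> conv (fun n => u n * x)%A (l * x).
Proof.
intros Hu; apply conv_of_bound with (fun n => ⟦x⟧ * ⟦u n - l⟧).
- intros n; replace (u n * x - l * x)%A with ((u n - l) * x)%A by nc_ring.
  rewrite Rmult_comm; apply norm_mul.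
- replace 0 with (⟦x⟧ * 0) by ring; exact (is_lim_seq_scal_l _ ⟦x⟧ 0 Hu).
Qed.

Lemma conv_mul u v l m (B : R) :
  (forall n, ⟦v n⟧ <= B) -> conv u l -> conv v m ->
  conv (fun n => u n * v n)%A (l * m).
Proof.
intros HB Hu Hv.
apply conv_of_bound with (fun n => B * ⟦u n - l⟧ + ⟦l⟧ * ⟦v n - m⟧).
- intros n.
  replace (u n * v n - l * m)%A with ((u n - l) * v n + l * (v n - m))%A by nc_ring.
  eapply Rle_trans; [apply norm_add|]; apply Rplus_le_compat; [|apply norm_mul].
  rewrite Rmult_comm; apply norm_mul_bound; [lra | apply HB].
- replace 0 with (B * 0 + ⟦l⟧ * 0) by ring; apply is_lim_seq_plus'.
  + exact (is_lim_seq_scal_l _ B 0 Hu).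
  + exact (is_lim_seq_scal_l _ ⟦l⟧ 0 Hv).
Qed.

Lemma conv_scal (k : C) u l : conv u l -> conv (fun n => k *: u n)%A (k *: l).
Proof.
intros Hu; apply conv_of_bound with (fun n => Cmod k * ⟦u n - l⟧).
- intros n; rewrite <- scal_sub; apply norm_scal_le.
- replace 0 with (Cmod k * 0) by ring; exact (is_lim_seq_scal_l _ (Cmod k) 0 Hu).
Qed.

Lemma conv_norm_le u l (B : R) : conv u l -> (forall n, ⟦u n⟧ <= B) -> ⟦l⟧ <= B.
Proof.
intros Hu HB.
apply (is_lim_seq_le (fun _ => ⟦l⟧) (fun n => B + ⟦u n - l⟧) ⟦l⟧ B).
- intros n; replace l with (u n - (u n - l))%A at 1 by nc_ring.
  eapply Rle_trans; [apply norm_sub|]; specialize (HB n); lra.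
- apply is_lim_seq_const.
- replace (Finite B) with (Finite (B + 0)) by (f_equal; ring).
  apply (is_lim_seq_plus' _ _ B 0); [apply is_lim_seq_const | exact Hu].
Qed.

Lemma conv_unique u l m : conv u l -> conv u m -> l = m.
Proof.
intros Hl Hm; apply sub_0_eq, norm_0_eq.
apply conv_norm_le with (fun n => u n - u n)%A.
- now apply conv_sub.
- intros n; replace (u n - u n)%A with (0 : A)%A by nc_ring.
  rewrite norm_0; lra.
Qed.

Lemma conv_commute x u l : (forall n, commute x (u n)) -> conv u l -> commute x l.
Proof.
intros H Hu; apply (conv_unique (fun n => x * u n)%A); [now apply conv_mul_l|].
apply conv_ext with (fun n => u n * x)%A; [|now apply conv_mul_r].
intros n; symmetry; apply H.
Qed.

Lemma conv_tail u l (N : nat) : conv u l -> conv (fun n => u (n + N)%nat) l.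
Proof.
intros Hu; unfold conv.
now apply (is_lim_seq_incr_n (fun n => ⟦u n - l⟧) N).
Qed.

End Limits.

(** * Averages over equidistributed points *)

Section Integral.

Context {A : BanachAlgebra}.
Implicit Types (f : R -> A).

Definition integral f (a b : R) : A := RInt (V := realify A) f a b.

Definition acontinuous f : Prop := forall t, continuous (f : R -> realify A) t.

Lemma acontinuous_ex f (a b : R) : acontinuous f -> ex_RInt (V := realify A) f a b.
Proof. intros Hc; apply ex_RInt_continuous; intros; apply Hc. Qed.

Lemma integral_chasles f (a b c : R) :
  acontinuous f -> integral f a c = (integral f a b + integral f b c)%A.
Proof.
intros Hc; symmetry.
apply (RInt_Chasles (V := realify A) f a b c); now apply acontinuous_ex.
Qed.

Lemma integral_step f (s h M : R) :
  acontinuous f -> 0 <= h -> (forall t, s <= t <= s + h -> ⟦f t - f s⟧ <= M) ->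
  ⟦integral f s (s + h) - RtoC h *: f s⟧ <= h * M.
Proof.
intros Hc Hh HM.
assert (Hex : ex_RInt (V := realify A) f s (s + h)) by now apply acontinuous_ex.
assert (Hk : ex_RInt (V := realify A) (fun _ => f s) s (s + h)) by apply ex_RInt_const.
replace (RtoC h *: f s)%A with (integral (fun _ => f s) s (s + h)).
2: { transitivity (RtoC (s + h - s)%R *: f s)%A; [exact (RInt_const (V := realify A) s (s + h) (f s))|].
     do 2 f_equal; ring. }
replace (h * M) with ((s + h - s) * M) by ring.
apply (norm_RInt_le_const (V := realify A)
         (fun t => (f t - f s)%A) s (s + h) _ M); [lra | exact HM|].
exact (is_RInt_minus (V := realify A) _ _ _ _ _ _
         (RInt_correct (V := realify A) _ _ _ Hex)
         (RInt_correct (V := realify A) _ _ _ Hk)).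
Qed.

End Integral.

Section Average.

Context {A : BanachAlgebra}.
Implicit Types (f g : R -> A) (x : A).

Definition node (n k : nat) : R := 2 * PI * INR k / INR (S n).

(** [sum_n] with values in [A] itself, like the other operations. *)
Definition asum (u : nat -> A) (n : nat) : A := sum_n u n.

Definition average f (n : nat) : A :=
  (RtoC (/ INR (S n)) *: asum (fun k => f (node n k)) n)%A.

Lemma node_range (n k : nat) : (k <= n)%nat -> 0 <= node n k <= 2 * PI.
Proof.
intros Hk; unfold node; pose proof PI_RGT_0.
assert (HN : 0 < INR (S n)) by (apply lt_0_INR; lia).
assert (Hk' : INR k <= INR (S n)) by (apply le_INR; lia).
pose proof (pos_INR k); split.
- apply Rmult_le_pos; [|left; now apply Rinv_0_lt_compat].
  apply Rmult_le_pos; lra.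
- apply Rmult_le_reg_r with (INR (S n)); [exact HN|].
  unfold Rdiv; rewrite Rmult_assoc, Rinv_l by lra.
  rewrite Rmult_1_r; apply Rmult_le_compat_l; lra.
Qed.

Lemma asum_S (u : nat -> A) (n : nat) : asum u (S n) = (asum u n + u (S n))%A.
Proof. exact (@sum_Sn A u n). Qed.

Lemma asum_0 (u : nat -> A) : asum u 0 = u O.
Proof. exact (@sum_O A u). Qed.

Lemma asum_ext (u v : nat -> A) (n : nat) :
  (forall k, (k <= n)%nat -> u k = v k) -> asum u n = asum v n.
Proof. apply (@sum_n_ext_loc A). Qed.

Lemma asum_sub (u v : nat -> A) (n : nat) :
  asum (fun k => u k - v k)%A n = (asum u n - asum v n)%A.
Proof.
induction n as [|n IH]; [now rewrite !asum_0|].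
rewrite !asum_S, IH; nc_ring.
Qed.

Lemma average_ext f g (n : nat) :
  (forall k, (k <= n)%nat -> f (node n k) = g (node n k)) -> average f n = average g n.
Proof. intros E; unfold average; f_equal; now apply asum_ext. Qed.

Lemma average_sub f g (n : nat) :
  average (fun t => f t - g t)%A n = (average f n - average g n)%A.
Proof. unfold average; now rewrite asum_sub, scal_sub. Qed.

Lemma average_mul_l x f (n : nat) :
  average (fun t => x * f t)%A n = (x * average f n)%A.
Proof.
unfold average; rewrite scal_mul_r; f_equal; exact (@sum_n_mult_l A x _ n).
Qed.

Lemma average_scal (k : C) f (n : nat) :
  average (fun t => k *: f t)%A n = (k *: average f n)%A.
Proof.
unfold average; rewrite scal_scal, Cmult_comm, <- scal_scal; f_equal.
exact (@sum_n_scal_l C_AbsRing A k _ n).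
Qed.

Lemma average_commute x f (n : nat) :
  (forall t, commute x (f t)) -> commute x (average f n).
Proof.
intros H; unfold average; apply commute_scal.
induction n as [|m IH] in |- * at 2; [rewrite asum_0; apply H|].
rewrite asum_S; unfold commute in *.
transitivity (x * asum (fun k => f (node n k)) m + x * f (node n (S m)))%A; [nc_ring|].
rewrite IH, H; nc_ring.
Qed.

Lemma average_norm_le f (B : R) (n : nat) :
  (forall t, 0 <= t <= 2 * PI -> ⟦f t⟧ <= B) -> ⟦average f n⟧ <= B.
Proof.
intros HB; unfold average.
assert (HN : 0 < INR (S n)) by (apply lt_0_INR; lia).
assert (G : forall m, (m <= n)%nat ->
  ⟦asum (fun k => f (node n k)) m⟧ <= INR (S m) * B).
{ induction m as [|m IH]; intros Hm.
  - rewrite asum_0; simpl; rewrite Rmult_1_l; apply HB, node_range; lia.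
  - rewrite asum_S, (S_INR (S m)), Rmult_plus_distr_r, Rmult_1_l.
    eapply Rle_trans; [apply norm_add|].
    apply Rplus_le_compat; [apply IH; lia | apply HB, node_range; lia]. }
eapply Rle_trans; [apply norm_scal_le|].
rewrite Cmod_R, Rabs_pos_eq by (left; now apply Rinv_0_lt_compat).
apply Rmult_le_reg_l with (INR (S n)); [exact HN|].
rewrite <- Rmult_assoc, Rinv_r, Rmult_1_l by lra; apply G; lia.
Qed.

(** A left Riemann sum of a Lipschitz function has error $O(1/n)$. *)
Lemma average_conv f (L : R) :
  0 <= L -> acontinuous f ->
  (forall s t, 0 <= s <= 2 * PI -> 0 <= t <= 2 * PI ->
     ⟦f t - f s⟧ <= L * Rabs (t - s)) ->
  conv (average f) (RtoC (/ (2 * PI)) *: integral f 0 (2 * PI)).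
Proof.
intros HL Hc Hlip; pose proof PI_RGT_0 as HPI.
apply conv_of_bound with (fun n => 2 * PI * L * / INR (S n)).
2: { replace 0 with (2 * PI * L * 0) by ring.
     apply (is_lim_seq_scal_l (fun n => / INR (S n)) (2 * PI * L) 0).
     apply (is_lim_seq_incr_1 (fun n => / INR n)).
     apply (is_lim_seq_inv _ p_infty); [apply is_lim_seq_INR | discriminate]. }
intros n; assert (HN : 0 < INR (S n)) by (apply lt_0_INR; lia).
set (h := 2 * PI / INR (S n)).
assert (Hh : 0 < h) by (apply Rdiv_lt_0_compat; lra).
assert (Hnode : forall k, node n k = h * INR k).
{ intros k; unfold node, h; field; lra. }
assert (HhN : h * INR (S n) = 2 * PI) by (unfold h; field; lra).
assert (Hstep : forall k, (k <= n)%nat ->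
  ⟦integral f (node n k) (node n k + h) - RtoC h *: f (node n k)⟧ <= h * (L * h)).
{ intros k Hk; pose proof (node_range n k Hk) as H1.
  assert (H2 : node n k + h <= 2 * PI).
  { rewrite Hnode, <- HhN.
    replace (h * INR k + h) with (h * INR (S k)) by (rewrite S_INR; ring).
    apply Rmult_le_compat_l; [lra | apply le_INR; lia]. }
  apply integral_step; [exact Hc | lra|].
  intros t Ht; eapply Rle_trans; [apply Hlip; lra|].
  rewrite Rabs_pos_eq by lra; apply Rmult_le_compat_l; lra. }
assert (G : forall m, (m <= n)%nat ->
  ⟦integral f 0 (node n m + h) - RtoC h *: asum (fun k => f (node n k)) m⟧
    <= INR (S m) * (h * (L * h))).
{ induction m as [|m IH]; intros Hm.
  - pose proof (Hstep O Hm) as St; rewrite asum_0; simpl.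
    replace (node n 0) with 0 in * by (rewrite Hnode; simpl; ring); lra.
  - rewrite (integral_chasles f 0 (node n m + h)) by exact Hc.
    pose proof (Hstep (S m) Hm) as St; specialize (IH ltac:(lia)).
    rewrite asum_S, scal_add, (S_INR (S m)).
    replace (node n m + h) with (node n (S m)) in *
      by (rewrite !Hnode, S_INR; ring).
    set (I1 := integral f 0 _) in *; set (I2 := integral f (node n (S m)) _) in *.
    set (S1 := asum _ _) in *; set (y := f _) in *.
    replace (I1 + I2 - (RtoC h *: S1 + RtoC h *: y))%A
      with ((I1 - RtoC h *: S1) + (I2 - RtoC h *: y))%A by nc_ring.
    eapply Rle_trans; [apply norm_add|]; lra. }
specialize (G n (le_n n)).
replace (node n n + h) with (2 * PI) in G by (rewrite Hnode, <- HhN, S_INR; ring).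
unfold average; set (I := integral _ _ _) in *; set (S1 := asum _ _) in *.
replace (RtoC (/ INR (S n)) *: S1)%A
  with (RtoC (/ (2 * PI)) *: (RtoC h *: S1))%A.
2: { rewrite scal_scal, <- RtoC_mult; unfold h; do 2 f_equal; field; lra. }
rewrite norm_sub_sym, <- scal_sub.
eapply Rle_trans; [apply norm_scal_le|].
rewrite Cmod_R, Rabs_pos_eq by (left; apply Rinv_0_lt_compat; lra).
apply Rmult_le_reg_l with (2 * PI); [lra|].
rewrite <- Rmult_assoc, Rinv_r, Rmult_1_l by lra.
eapply Rle_trans; [exact G|]; right; unfold h; field; lra.
Qed.

Definition mean f : A := (RtoC (/ (2 * PI)) *: integral f 0 (2 * PI))%A.

(** Continuity on the whole line makes every integral exist; the Lipschitz bound
    on one period controls the Riemann sums. *)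
Definition regular f : Prop :=
  acontinuous f /\
  exists L, 0 <= L /\ forall s t, 0 <= s <= 2 * PI -> 0 <= t <= 2 * PI ->
    ⟦f t - f s⟧ <= L * Rabs (t - s).

Lemma average_mean f : regular f -> conv (average f) (mean f).
Proof. intros (Hc & L & HL & Hlip); now apply average_conv with L. Qed.

Lemma continuous_of_bound f (t : R) :
  (forall eps, 0 < eps -> exists delta, 0 < delta /\
     forall s, Rabs (s - t) < delta -> ⟦f s - f t⟧ < eps) ->
  continuous (f : R -> realify A) t.
Proof.
intros H.
apply (proj2 (filterlim_locally_ball_norm (U := realify A) f (f t))); intros eps.
destruct (H eps (cond_pos eps)) as (delta & Hd & B).
exists (mkposreal delta Hd); intros s Hs; exact (B s Hs).
Qed.

Lemma acontinuous_bound f (t eps : R) :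
  acontinuous f -> 0 < eps -> exists delta, 0 < delta /\
    forall s, Rabs (s - t) < delta -> ⟦f s - f t⟧ < eps.
Proof.
intros Hc He.
pose proof (proj1 (filterlim_locally_ball_norm (U := realify A) f (f t)) (Hc t)
              (mkposreal eps He)) as [delta B].
exists delta; split; [apply cond_pos|]; intros s Hs; exact (B s Hs).
Qed.

Lemma regular_dominated f g (K : R) :
  0 <= K -> (forall s t, ⟦g t - g s⟧ <= K * ⟦f t - f s⟧) -> regular f -> regular g.
Proof.
intros HK D (Hc & L & HL & Hlip); split.
- intros t; apply continuous_of_bound; intros eps He.
  destruct (acontinuous_bound f t (eps / (K + 1)) Hc) as (delta & Hd & B).
  { apply Rdiv_lt_0_compat; lra. }
  exists delta; split; [exact Hd|]; intros s Hs.
  eapply Rle_lt_trans; [apply D|].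
  apply Rle_lt_trans with (K * (eps / (K + 1))).
  + apply Rmult_le_compat_l; [exact HK | left; now apply B].
  + apply Rmult_lt_reg_r with (K + 1); [lra|].
    replace (K * (eps / (K + 1)) * (K + 1)) with (K * eps) by (field; lra); nra.
- exists (K * L); split; [now apply Rmult_le_pos|]; intros s t Hs Ht.
  eapply Rle_trans; [apply D|]; rewrite Rmult_assoc.
  apply Rmult_le_compat_l; [exact HK | now apply Hlip].
Qed.

Lemma acontinuous_bounded f (a b : R) :
  acontinuous f -> exists M, 0 < M /\ forall t, a <= t <= b -> ⟦f t⟧ <= M.
Proof.
intros Hc.
destruct (bounded_continuity (V := realify A) f a b) as [M HM]; [intros; apply Hc|].
exists (Rmax M 1); split; [eapply Rlt_le_trans; [|apply Rmax_r]; lra|].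
intros t Ht; eapply Rle_trans; [left; exact (HM t Ht) | apply Rmax_l].
Qed.

End Average.

(** * The resolvent on a circle *)

Section Resolvent.

Context {A : BanachAlgebra}.
Implicit Types (c x y : A) (mu nu : C).

Lemma is_inverse_unique x y z : is_inverse x y -> is_inverse x z -> y = z.
Proof.
intros [_ Hy] [Hz _].
change (y * x = 1)%A in Hy; change (x * z = 1)%A in Hz.
transitivity (y * (x * z))%A; [rewrite Hz; nc_ring|].
rewrite mul_assoc, Hy; nc_ring.
Qed.

Lemma inv_spec x : invertible x -> is_inverse x (inv x).
Proof.
intros [y Hy]; apply (iota_correct (V := A) (is_inverse x)); exists y; split; [exact Hy|].
intros z; now apply is_inverse_unique.
Qed.

Lemma resolvent_l c mu :
  invertible (shift c mu) -> (c * resolvent c mu = mu *: resolvent c mu - 1)%A.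
Proof.
intros H; destruct (inv_spec _ H) as [E _]; fold (resolvent c mu) in E.
set (r := resolvent c mu) in *.
change (((mu *: 1 - c) * r)%A = 1%A) in E.
replace (mu *: r)%A with ((mu *: 1) * r)%A by (rewrite scal_mul_l; f_equal; nc_ring).
transitivity ((mu *: 1) * r - (mu *: 1 - c) * r)%A; [nc_ring | now rewrite E].
Qed.

Lemma resolvent_r c mu :
  invertible (shift c mu) -> (resolvent c mu * c = mu *: resolvent c mu - 1)%A.
Proof.
intros H; destruct (inv_spec _ H) as [_ E]; fold (resolvent c mu) in E.
set (r := resolvent c mu) in *.
change ((r * (mu *: 1 - c))%A = 1%A) in E.
replace (mu *: r)%A with (r * (mu *: 1))%A by (rewrite scal_mul_r; f_equal; nc_ring).
transitivity (r * (mu *: 1) - r * (mu *: 1 - c))%A; [nc_ring | now rewrite E].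
Qed.

Lemma resolvent_commute c mu x :
  invertible (shift c mu) -> commute x c -> commute x (resolvent c mu).
Proof.
intros H Hx; pose proof (resolvent_l c mu H) as El; pose proof (resolvent_r c mu H) as Er.
set (r := resolvent c mu) in *; unfold commute in *.
(* Expand both sides of $r(cx)r = r(xc)r$ with $rc = cr = \mu r - 1$. *)
assert (E : (r * (c * x) * r = r * (x * c) * r)%A) by now rewrite Hx.
replace (r * (c * x) * r)%A with ((r * c) * x * r)%A in E by nc_ring.
replace (r * (x * c) * r)%A with (r * x * (c * r))%A in E by nc_ring.
rewrite El, Er in E.
replace ((mu *: r - 1) * x * r)%A with ((mu *: r) * (x * r) - x * r)%A in E by nc_ring.
replace (r * x * (mu *: r - 1))%A with ((r * x) * (mu *: r) - r * x)%A in E by nc_ring.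
rewrite scal_mul_l, scal_mul_r, mul_assoc in E.
set (z := (mu *: (r * x * r))%A) in *.
transitivity (z - (z - x * r))%A; [nc_ring|]; rewrite E; nc_ring.
Qed.

Lemma resolvent_identity c mu nu :
  invertible (shift c mu) -> invertible (shift c nu) ->
  (resolvent c nu - resolvent c mu
   = (mu - nu)%C *: (resolvent c nu * resolvent c mu))%A.
Proof.
intros Hm Hn; pose proof (resolvent_l c mu Hm) as El.
pose proof (resolvent_r c nu Hn) as Er.
set (r := resolvent c mu) in *; set (q := resolvent c nu) in *.
rewrite sub_scal.
replace (mu *: (q * r))%A with (q * (mu *: r))%A by apply scal_mul_r.
replace (nu *: (q * r))%A with ((nu *: q) * r)%A by apply scal_mul_l.
replace (mu *: r)%A with (c * r + 1)%A by (rewrite El; nc_ring).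
replace (nu *: q)%A with (q * c + 1)%A by (rewrite Er; nc_ring).
nc_ring.
Qed.

Lemma resolvent_lipschitz c mu nu (M N : R) :
  invertible (shift c mu) -> invertible (shift c nu) ->
  ⟦resolvent c mu⟧ <= M -> ⟦resolvent c nu⟧ <= N ->
  ⟦resolvent c nu - resolvent c mu⟧ <= Cmod (mu - nu) * (N * M).
Proof.
intros Hm Hn BM BN; rewrite resolvent_identity by assumption.
eapply Rle_trans; [apply norm_scal_le|].
apply Rmult_le_compat_l; [apply Cmod_ge_0 | now apply norm_mul_bound].
Qed.

(** By the resolvent identity, a bound at one point propagates to neighbouring
    points of the resolvent set. *)
Lemma resolvent_near c mu nu (M : R) :
  invertible (shift c mu) -> invertible (shift c nu) ->
  ⟦resolvent c mu⟧ <= M -> Cmod (mu - nu) * M <= 1 / 2 -> ⟦resolvent c nu⟧ <= 2 * M.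
Proof.
intros Hm Hn BM Hd.
pose proof (resolvent_lipschitz c mu nu M _ Hm Hn BM (Rle_refl _)) as E.
set (r := resolvent c mu) in *; set (q := resolvent c nu) in *.
assert (T : ⟦q⟧ <= ⟦r⟧ + ⟦q - r⟧).
{ replace q with (r + (q - r))%A at 1 by nc_ring; apply norm_add. }
pose proof (norm_nonneg q); nra.
Qed.

End Resolvent.

Definition circle (r t : R) : C := (r * expi t)%C.

Lemma expi_add (s t : R) : expi (s + t) = (expi s * expi t)%C.
Proof. unfold expi, Cmult; simpl; rewrite cos_plus, sin_plus; f_equal; ring. Qed.

Lemma expi_pow (t : R) (m : nat) : (expi t ^ m)%C = expi (INR m * t).
Proof.
induction m as [|m IH].
- simpl; rewrite Rmult_0_l; unfold expi; now rewrite cos_0, sin_0.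
- rewrite Cpow_S, IH, <- expi_add, S_INR; f_equal; ring.
Qed.

Lemma expi_2PI : expi (2 * PI) = 1.
Proof. unfold expi; now rewrite cos_2PI, sin_2PI. Qed.

Lemma expi_neq_1 (t : R) : 0 < t < 2 * PI -> expi t <> 1.
Proof.
intros Ht E; assert (C1 : cos t = 1) by exact (f_equal fst E).
pose proof (sin_gt_0 (t / 2) ltac:(lra) ltac:(lra)) as S0.
replace t with (2 * (t / 2)) in C1 by field.
rewrite cos_2a_sin in C1; nra.
Qed.

Lemma Cmod_expi (t : R) : Cmod (expi t) = 1.
Proof.
transitivity (sqrt 1); [|apply sqrt_1].
unfold Cmod, expi; simpl; f_equal.
pose proof (sin2_cos2 t) as E; unfold Rsqr in E; lra.
Qed.

Lemma Cmod_circle (r t : R) : 0 <= r -> Cmod (circle r t) = r.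
Proof.
intros Hr; unfold circle; rewrite Cmod_mult, Cmod_expi, Cmod_R, Rabs_pos_eq by exact Hr.
ring.
Qed.

Lemma expi_lipschitz (s t : R) : Cmod (expi s - expi t) <= 2 * Rabs (s - t).
Proof.
assert (Hc : Rabs (cos s - cos t) <= 1 * Rabs (s - t)).
{ apply bounded_variation with (fun x => - sin x); intros x _; split.
  - auto_derive; trivial; ring.
  - rewrite Rabs_Ropp; apply Rabs_le; pose proof (SIN_bound x); lra. }
assert (Hs : Rabs (sin s - sin t) <= 1 * Rabs (s - t)).
{ apply bounded_variation with cos; intros x _; split.
  - auto_derive; trivial; ring.
  - apply Rabs_le; pose proof (COS_bound x); lra. }
replace (expi s - expi t)%C
  with (RtoC (cos s - cos t) + Ci * RtoC (sin s - sin t))%C.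
2: { apply injective_projections; simpl; ring. }
eapply Rle_trans; [apply Cmod_triangle|].
rewrite Cmod_mult, !Cmod_R, Cmod_Ci; lra.
Qed.

Lemma circle_lipschitz (r s t : R) :
  0 <= r -> Cmod (circle r s - circle r t) <= 2 * r * Rabs (s - t).
Proof.
intros Hr; unfold circle.
replace (r * expi s - r * expi t)%C with (r * (expi s - expi t))%C by ring.
rewrite Cmod_mult, Cmod_R, Rabs_pos_eq by exact Hr.
replace (2 * r * Rabs (s - t)) with (r * (2 * Rabs (s - t))) by ring.
apply Rmult_le_compat_l; [exact Hr | apply expi_lipschitz].
Qed.

Lemma circle_radial (r s t : R) : Cmod (circle r t - circle s t) = Rabs (r - s).
Proof.
unfold circle; replace (r * expi t - s * expi t)%C with ((r - s)%R * expi t)%C.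
- rewrite Cmod_mult, Cmod_expi, Cmod_R; ring.
- rewrite RtoC_minus; ring.
Qed.

Lemma circle_pow (r t : R) (m : nat) :
  (circle r t ^ m = (r ^ m)%R * expi (INR m * t))%C.
Proof. unfold circle; now rewrite Cpow_mult_l, expi_pow, RtoC_pow. Qed.

Section RootsOfUnity.

Context {A : BanachAlgebra}.

Lemma geometric_sum (w : C) (x : A) (n : nat) :
  ((w - RtoC 1)%C *: asum (fun k => (w ^ k)%C *: x) n = ((w ^ S n)%C - RtoC 1)%C *: x)%A.
Proof.
induction n as [|n IH].
- rewrite asum_0; simpl; rewrite scal_scal; f_equal; ring.
- rewrite asum_S, scal_add, IH, scal_scal, <- add_scal; f_equal.
  rewrite !Cpow_S; ring.
Qed.

(** A geometric sum over a full period, whose ratio is a root of unity other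
    than $1$. *)
Lemma average_circle_pow (r : R) (m n : nat) (x : A) :
  (0 < m <= n)%nat -> average (fun t => (circle r t ^ m)%C *: x)%A n = 0%A.
Proof.
intros Hm; set (w := expi (INR m * (2 * PI / INR (S n)))).
assert (HN : 0 < INR (S n)) by (apply lt_0_INR; lia).
rewrite (average_ext _ (fun t => RtoC (r ^ m) *: (expi (INR m * t) *: x))%A)
  by (intros k _; now rewrite scal_scal, <- circle_pow).
rewrite average_scal.
replace (average _ n) with (0 : A)%A; [apply scal_0_r|]; symmetry.
unfold average.
rewrite (asum_ext _ (fun k => (w ^ k)%C *: x)%A).
2: { intros k _; f_equal; unfold w, node; rewrite expi_pow; f_equal; field; lra. }
assert (Hw : (w - 1)%C <> 0).
{ apply Cminus_eq_contra, expi_neq_1; pose proof PI_RGT_0.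
  assert (0 < INR m) by (apply lt_0_INR; lia).
  assert (INR m < INR (S n)) by (apply lt_INR; lia).
  replace (INR m * (2 * PI / INR (S n))) with (2 * PI * (INR m / INR (S n)))
    by (field; lra).
  assert (0 < INR m / INR (S n) < 1).
  { split; [now apply Rdiv_lt_0_compat|].
    apply Rmult_lt_reg_r with (INR (S n)); [exact HN|].
    unfold Rdiv; rewrite Rmult_assoc, Rinv_l; lra. }
  split; [apply Rmult_lt_0_compat; lra|].
  rewrite <- (Rmult_1_r (2 * PI)) at 2; apply Rmult_lt_compat_l; lra. }
pose proof (geometric_sum w x n) as G.
assert (W1 : (w ^ S n)%C = 1).
{ unfold w; rewrite expi_pow.
  replace (INR (S n) * (INR m * (2 * PI / INR (S n)))) with (INR m * (2 * PI))
    by (field; lra).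
  rewrite <- expi_pow, expi_2PI; apply Cpow_1_l. }
rewrite W1 in G.
set (S1 := asum _ n) in *.
assert (S0 : S1 = 0%A); [|rewrite S0; apply scal_0_r].
replace S1 with ((/ (w - RtoC 1))%C *: ((w - RtoC 1)%C *: S1))%A.
- rewrite G; replace (1 - 1)%C with (RtoC 0) by ring.
  replace (RtoC 0 *: x)%A with (0 : A)%A; [apply scal_0_r|].
  symmetry; exact (@scal_zero_l C_AbsRing A x).
- rewrite scal_scal, Cinv_l by exact Hw; apply scal_1.
Qed.

Lemma average_const (x : A) (n : nat) : average (fun _ => x) n = x.
Proof.
unfold average.
assert (G : forall m, asum (fun _ => x) m = (RtoC (INR (S m)) *: x)%A).
{ induction m as [|m IH].
  - rewrite asum_0; simpl; symmetry; apply scal_1.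
  - rewrite asum_S, IH, (S_INR (S m)), RtoC_plus, add_scal, scal_1; reflexivity. }
rewrite G, scal_scal, <- RtoC_mult, Rinv_l by (apply not_0_INR; lia).
apply scal_1.
Qed.

Lemma circle_node_pow (r : R) (n k : nat) :
  (circle r (node n k) ^ S n)%C = (r ^ S n)%R.
Proof.
rewrite circle_pow; unfold node.
replace (INR (S n) * (2 * PI * INR k / INR (S n))) with (INR k * (2 * PI)).
- rewrite <- expi_pow, expi_2PI, Cpow_1_l; ring.
- field; apply not_0_INR; lia.
Qed.

End RootsOfUnity.

(** * Circle averages of the resolvent *)

Definition resolvent_circle {A : BanachAlgebra} (c : A) (r : R) : Prop :=
  0 <= r /\ forall mu, Cmod mu = r -> invertible (shift c mu).

Section Moments.

Context {A : BanachAlgebra}.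
Context (c : A) (r : R) (Hcirc : resolvent_circle c r).

Lemma circle_invertible (t : R) : invertible (shift c (circle r t)).
Proof. destruct Hcirc as [H0 H]; apply H, Cmod_circle, H0. Qed.

Lemma resolvent_circle_acontinuous : acontinuous (fun t => resolvent c (circle r t)).
Proof.
intros t; apply continuous_of_bound; intros eps He.
set (M := ⟦resolvent c (circle r t)⟧ + 1).
assert (HM : 0 < M) by (unfold M; pose proof (norm_nonneg (resolvent c (circle r t))); lra).
assert (BM : ⟦resolvent c (circle r t)⟧ <= M) by (unfold M; lra).
pose proof (proj1 Hcirc) as Hr.
set (K := 2 * r + 1).
(* [d] makes both $|\mu-\nu| M \le 1/2$ and $|\mu-\nu| \cdot 2M^2 < \varepsilon$. *)
set (d := Rmin (1 / 2 / M) (eps / (2 * M * M))).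
assert (Hd : 0 < d).
{ apply Rmin_glb_lt; apply Rdiv_lt_0_compat; try lra.
  apply Rmult_lt_0_compat; lra. }
exists (d / K); split; [apply Rdiv_lt_0_compat; unfold K; lra|].
intros s Hs.
assert (Hst : Cmod (circle r t - circle r s) < d).
{ eapply Rle_lt_trans; [apply circle_lipschitz, Hr|].
  rewrite Rabs_minus_sym; pose proof (Rabs_pos (s - t)).
  apply (Rmult_lt_compat_l K) in Hs; [|unfold K; lra].
  replace (K * (d / K)) with d in Hs by (field; unfold K; lra).
  unfold K in Hs; lra. }
assert (D1 : Cmod (circle r t - circle r s) * M <= 1 / 2).
{ replace (1 / 2) with (1 / 2 / M * M) by (field; lra).
  apply Rmult_le_compat_r; [lra|]; left; eapply Rlt_le_trans; [exact Hst | apply Rmin_l]. }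
pose proof (circle_invertible t) as It; pose proof (circle_invertible s) as Is.
pose proof (resolvent_near _ _ _ M It Is BM D1) as Bs.
eapply Rle_lt_trans; [apply (resolvent_lipschitz _ _ _ M (2 * M) It Is BM Bs)|].
apply Rlt_le_trans with (eps / (2 * M * M) * (2 * M * M)); [|right; field; lra].
apply Rmult_lt_compat_r; [apply Rmult_lt_0_compat; lra|].
eapply Rlt_le_trans; [exact Hst | apply Rmin_r].
Qed.

Lemma resolvent_circle_bounded :
  exists M, 0 < M /\
    forall t, 0 <= t <= 2 * PI -> ⟦resolvent c (circle r t)⟧ <= M.
Proof. apply acontinuous_bounded, resolvent_circle_acontinuous. Qed.

Lemma resolvent_circle_regular : regular (fun t => resolvent c (circle r t)).
Proof.
split; [apply resolvent_circle_acontinuous|].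
destruct resolvent_circle_bounded as (M & HM & B); pose proof (proj1 Hcirc) as Hr.
assert (HMM : 0 <= M * M) by (apply Rmult_le_pos; lra).
exists (2 * r * (M * M)); split; [apply Rmult_le_pos; lra|].
intros s t Hs Ht.
eapply Rle_trans.
{ apply (resolvent_lipschitz c _ _ M M); auto using circle_invertible. }
replace (2 * r * (M * M) * Rabs (t - s)) with (2 * r * Rabs (t - s) * (M * M)) by ring.
apply Rmult_le_compat_r; [exact HMM|].
rewrite (Rabs_minus_sym t s); now apply circle_lipschitz.
Qed.

(** The quadrature of $\frac1{2\pi i}\oint \mu^{m-1}(\mu-c)^{-1}d\mu$ at the
    roots of unity of order [S n]. *)
Definition moment (m n : nat) : A :=
  average (fun t => (circle r t ^ m)%C *: resolvent c (circle r t))%A n.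

Lemma mul_moment (m n : nat) :
  (c * moment m n
   = moment (S m) n - average (fun t => (circle r t ^ m)%C *: 1) n)%A.
Proof.
unfold moment; rewrite <- average_mul_l, <- average_sub; apply average_ext.
intros k _; rewrite scal_mul_r, resolvent_l by apply circle_invertible.
rewrite scal_sub, scal_scal; do 2 f_equal; rewrite Cpow_S; ring.
Qed.

(** In the limit this exhibits $1-p$ as a multiple of [c]. *)
Lemma mul_moment_0 (n : nat) : (c * moment 0 n = moment 1 n - 1)%A.
Proof.
rewrite mul_moment; f_equal.
rewrite (average_ext _ (fun _ => 1%A)); [apply average_const|].
intros k _; apply scal_1.
Qed.

(** The quadrature integrates the powers $\mu,\dots,\mu^n$ exactly, so that
    multiplication by [c] and by $\mu$ agree below the number of nodes. *)
Lemma pow_mul_moment (m n : nat) :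
  (m <= n)%nat -> (c ^ m * moment 1 n = moment (S m) n)%A.
Proof.
induction m as [|m IH]; intros Hm; [simpl; nc_ring|].
rewrite pow_S, <- mul_assoc, IH, mul_moment by lia.
rewrite average_circle_pow by lia; nc_ring.
Qed.

(** The quadrature is exact enough to give $E = (1 - (c/r)^{N})^{-1}$ for $N$
    nodes. *)
Lemma pow_order_mul_moment (n : nat) :
  (c ^ S n * moment 1 n = (r ^ S n)%R *: moment 1 n - (r ^ S n)%R *: 1)%A.
Proof.
rewrite pow_S, <- mul_assoc, pow_mul_moment, mul_moment by lia; f_equal.
- unfold moment; rewrite <- average_scal; apply average_ext; intros k _.
  rewrite scal_scal; f_equal.
  rewrite Cpow_S, circle_node_pow, Cpow_1_r; ring.
- rewrite <- (average_const ((r ^ S n)%R *: 1)%A n); apply average_ext; intros k _.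
  now rewrite circle_node_pow.
Qed.

(** Membership in the bicommutant of [c] passes from the resolvents to their
    averages and then to the limits. *)
Lemma moment_commute (m n : nat) (x : A) : commute x c -> commute x (moment m n).
Proof.
intros Hx; apply average_commute; intros t.
apply commute_scal, resolvent_commute; [apply circle_invertible | exact Hx].
Qed.

Definition projection : A := mean (fun t => circle r t *: resolvent c (circle r t))%A.
(** Up to sign, the inverse of [c] on the complement of the projection. *)
Definition coprojection : A := mean (fun t => resolvent c (circle r t)).

Lemma circle_scal_resolvent (t : R) :
  (circle r t *: resolvent c (circle r t) = c * resolvent c (circle r t) + 1)%A.
Proof. rewrite resolvent_l by apply circle_invertible; nc_ring. Qed.

Lemma circle_scal_resolvent_sub (s t : R) :
  (circle r t *: resolvent c (circle r t) - circle r s *: resolvent c (circle r s)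
   = c * (resolvent c (circle r t) - resolvent c (circle r s)))%A.
Proof. rewrite !circle_scal_resolvent; nc_ring. Qed.

Lemma conv_moment_1 : conv (moment 1) projection.
Proof.
apply conv_ext with (average (fun t => circle r t *: resolvent c (circle r t))%A).
- intros n; apply average_ext; intros k _; now rewrite Cpow_1_r.
- apply average_mean; apply regular_dominated with (3 := resolvent_circle_regular) (K := ⟦c⟧).
  + apply norm_nonneg.
  + intros s t; rewrite circle_scal_resolvent_sub; apply norm_mul.
Qed.

Lemma conv_moment_0 : conv (moment 0) coprojection.
Proof.
apply conv_ext with (average (fun t => resolvent c (circle r t))).
- intros n; apply average_ext; intros k _; symmetry; apply scal_1.
- apply average_mean, resolvent_circle_regular.
Qed.

Lemma mul_coprojection : (c * coprojection = projection - 1)%A.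
Proof.
apply (conv_unique (fun n => c * moment 0 n)%A).
- apply conv_mul_l, conv_moment_0.
- apply conv_ext with (fun n => moment 1 n - 1)%A.
  + intros n; symmetry; apply mul_moment_0.
  + apply conv_sub; [apply conv_moment_1 | apply conv_const].
Qed.

Lemma projection_commute (x : A) : commute x c -> commute x projection.
Proof.
intros Hx; apply conv_commute with (2 := conv_moment_1); intros n.
now apply moment_commute.
Qed.

Lemma coprojection_commute (x : A) : commute x c -> commute x coprojection.
Proof.
intros Hx; apply conv_commute with (2 := conv_moment_0); intros n.
now apply moment_commute.
Qed.

Lemma moment_bounded :
  exists M, 0 < M /\ forall m n, ⟦moment m n⟧ <= r ^ m * M.
Proof.
destruct resolvent_circle_bounded as (M & HM & B); exists M; split; [exact HM|].
intros m n; apply average_norm_le; intros t Ht.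
eapply Rle_trans; [apply norm_scal_le|].
rewrite Cmod_pow, Cmod_circle by apply Hcirc.
apply Rmult_le_compat_l; [apply pow_le, Hcirc | now apply B].
Qed.

(** For a fixed exponent the number of nodes eventually exceeds it. *)
Lemma pow_mul_projection_bound :
  exists M, 0 < M /\ forall m, ⟦c ^ m * projection⟧ <= r ^ S m * M.
Proof.
destruct moment_bounded as (M & HM & B); exists M; split; [exact HM|]; intros m.
apply conv_norm_le with (fun n => c ^ m * moment 1 (n + m))%A.
- apply conv_mul_l, (conv_tail (moment 1)), conv_moment_1.
- intros n; rewrite pow_mul_moment by lia; apply B.
Qed.

End Moments.

Section TwoRadii.

Context {A : BanachAlgebra}.
Implicit Types c : A.

Lemma ratio_pow_lim (s r : R) :
  0 <= s < r -> is_lim_seq (fun n => (s / r) ^ S n) 0.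
Proof.
intros Hsr; apply (is_lim_seq_incr_1 (fun n => (s / r) ^ n)), is_lim_seq_geom.
rewrite Rabs_pos_eq.
- apply Rmult_lt_reg_r with r; [lra|].
  unfold Rdiv; rewrite Rmult_assoc, Rinv_l; lra.
- apply Rmult_le_pos; [lra | left; apply Rinv_0_lt_compat; lra].
Qed.

(** With $u = c^N$ the quadratures are $E_r = r^N/(r^N-u)$ and
    $E_s = s^N/(s^N-u)$; a partial fraction expansion gives
    $E_sE_r - E_s = (s/r)^N(E_sE_r - E_r)$. *)
Lemma moment_partial_fraction c (s r : R) (n : nat) :
  0 < r -> resolvent_circle c s -> resolvent_circle c r ->
  (moment c s 1 n * moment c r 1 n - moment c s 1 n
   = ((s / r) ^ S n)%R *: (moment c s 1 n * moment c r 1 n - moment c r 1 n))%A.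
Proof.
intros Hr Hs Hcr.
pose proof (pow_order_mul_moment c s Hs n) as Es.
pose proof (pow_order_mul_moment c r Hcr n) as Er.
assert (Hcom : commute (c ^ S n) (moment c s 1 n)).
{ apply moment_commute; [exact Hs|]; apply commute_sym, commute_pow; reflexivity. }
unfold commute in Hcom; rewrite Es in Hcom.
set (es := moment c s 1 n) in *; set (er := moment c r 1 n) in *; set (u := (c ^ S n)%A) in *.
assert (rn : r ^ S n <> 0) by (apply pow_nonzero; lra).
assert (E : (es * (u * er) = (es * u) * er)%A) by nc_ring.
rewrite Er, <- Hcom in E.
set (a := r ^ S n) in *; set (b := s ^ S n) in *.
replace (es * (a *: er - a *: 1))%A with (a *: (es * er - es))%A in E.
2: { rewrite <- scal_sub, scal_mul_r; f_equal; nc_ring. }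
replace ((b *: es - b *: 1) * er)%A with (b *: (es * er - er))%A in E.
2: { rewrite <- scal_sub, scal_mul_l; f_equal; nc_ring. }
replace (RtoC ((s / r) ^ S n)) with (RtoC (/ a) * RtoC b)%C.
2: { rewrite <- RtoC_mult; f_equal; unfold a, b, Rdiv.
     rewrite Rpow_mult_distr, pow_inv; ring. }
rewrite <- scal_scal, <- E, scal_scal, <- RtoC_mult, Rinv_l by exact rn.
symmetry; apply scal_1.
Qed.

Lemma projection_mul_smaller c (s r : R) :
  s < r -> resolvent_circle c s -> resolvent_circle c r ->
  (projection c s * projection c r = projection c s)%A.
Proof.
intros Hsr Hs Hr; pose proof (proj1 Hs) as Hs0.
destruct (moment_bounded c s Hs) as (M & HM & BM).
destruct (moment_bounded c r Hr) as (N & HN & BN).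
set (es := moment c s 1); set (er := moment c r 1).
assert (Ber : forall n, ⟦er n⟧ <= r * N).
{ intros n; eapply Rle_trans; [apply BN | simpl; lra]. }
assert (Bes : forall n, ⟦es n⟧ <= s * M).
{ intros n; eapply Rle_trans; [apply BM | simpl; lra]. }
assert (L1 : conv (fun n => es n * er n - es n)%A
               (projection c s * projection c r - projection c s)).
{ apply conv_sub; [|now apply conv_moment_1].
  apply conv_mul with (r * N); trivial; now apply conv_moment_1. }
assert (L2 : conv (fun n => es n * er n - es n)%A 0).
{ set (B := s * M * (r * N) + r * N).
  apply conv_of_bound with (fun n => B * (s / r) ^ S n).
  - intros n; replace (es n * er n - es n - 0)%A with (es n * er n - es n)%A by nc_ring.
    unfold es, er; rewrite moment_partial_fraction by (trivial; lra).
    fold es er; eapply Rle_trans; [apply norm_scal_le|].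
    assert (P : 0 <= (s / r) ^ S n).
    { apply pow_le, Rmult_le_pos; [lra | left; apply Rinv_0_lt_compat; lra]. }
    rewrite Cmod_R, Rabs_pos_eq by exact P.
    rewrite (Rmult_comm B); apply Rmult_le_compat_l; [exact P|].
    eapply Rle_trans; [apply norm_sub|].
    apply Rplus_le_compat; [now apply norm_mul_bound | apply Ber].
  - replace 0 with (B * 0) by ring.
    apply (is_lim_seq_scal_l _ B 0), ratio_pow_lim; lra. }
apply sub_0_eq, (conv_unique _ _ _ L1 L2).
Qed.

(** The integrands differ by $c$ times a difference of resolvents at points
    [Rabs (r - s)] apart. *)
Lemma projection_near c (r : R) :
  0 < r -> resolvent_circle c r ->
  exists delta K, 0 < delta /\ 0 <= K /\
    forall s, resolvent_circle c s -> Rabs (r - s) < delta ->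
      ⟦projection c r - projection c s⟧ <= K * Rabs (r - s).
Proof.
intros Hr Hcr; destruct (resolvent_circle_bounded c r Hcr) as (M & HM & B).
exists (1 / 2 / M), (⟦c⟧ * (2 * M * M)); split; [|split].
- apply Rdiv_lt_0_compat; lra.
- apply Rmult_le_pos; [apply norm_nonneg|].
  apply Rmult_le_pos; lra.
- intros s Hcs Hs.
  apply conv_norm_le with (fun n => moment c r 1 n - moment c s 1 n)%A.
  { apply conv_sub; now apply conv_moment_1. }
  intros n; unfold moment; rewrite <- average_sub.
  apply average_norm_le; intros t Ht.
  rewrite !Cpow_1_r, !circle_scal_resolvent by assumption.
  set (q := resolvent c (circle r t)); set (q' := resolvent c (circle s t)).
  replace (c * q + 1 - (c * q' + 1))%A with (c * (q - q'))%A by nc_ring.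
  rewrite Rmult_assoc; apply norm_mul_bound; [lra|].
  assert (D : Cmod (circle r t - circle s t) * M <= 1 / 2).
  { rewrite circle_radial; replace (1 / 2) with (1 / 2 / M * M) by (field; lra).
    apply Rmult_le_compat_r; lra. }
  pose proof (circle_invertible c r Hcr t) as Ir.
  pose proof (circle_invertible c s Hcs t) as Is.
  pose proof (B t Ht) as Br.
  pose proof (resolvent_near c _ _ M Ir Is Br D) as Bs.
  rewrite norm_sub_sym, <- circle_radial with (t := t), Rmult_comm.
  now apply resolvent_lipschitz.
Qed.

(** The indicator of $\{f \ne f(a)\}$ has derivative $0$ everywhere, once $f$ is
    extended by constants outside the interval. *)
Lemma locally_constant_eq {T : Type} (f : R -> T) (a b : R) :
  a < b ->
  (forall x, a <= x <= b -> exists delta, 0 < delta /\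
     forall y, a <= y <= b -> Rabs (y - x) < delta -> f y = f x) ->
  f a = f b.
Proof.
intros Hab Hloc.
set (clamp x := Rmax a (Rmin b x)).
assert (Hcl : forall x, a <= clamp x <= b).
{ intros x; unfold clamp; split; [apply Rmax_l|].
  apply Rmax_lub; [lra | apply Rmin_l]. }
assert (Hid : forall x, a <= x <= b -> clamp x = x).
{ intros x Hx; unfold clamp; rewrite Rmin_right, Rmax_right; lra. }
assert (Hlip : forall x y, a <= x <= b -> Rabs (clamp y - x) <= Rabs (y - x)).
{ intros x y Hx; unfold clamp, Rmax, Rmin.
  destruct (Rle_dec b y), (Rle_dec a _); unfold Rabs;
    repeat destruct Rcase_abs; lra. }
set (g x := if excluded_middle_informative (f (clamp x) = f a) then 0 else 1 : R).
assert (E : g a = g b).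
{ apply (eq_is_derive (V := R_NormedModule) g a b); [|exact Hab].
  intros x Hx; destruct (Hloc x Hx) as (delta & Hd & B).
  apply (is_derive_ext_loc (fun _ => g x)); [|apply is_derive_const].
  exists (mkposreal delta Hd); intros y Hy.
  change (Rabs (y - x) < delta) in Hy; unfold g.
  rewrite (B (clamp y) (Hcl y) (Rle_lt_trans _ _ _ (Hlip x y Hx) Hy)).
  now rewrite (Hid x Hx). }
unfold g in E; rewrite !Hid in E by lra.
destruct (excluded_middle_informative (f a = f a)); [|congruence].
destruct (excluded_middle_informative (f b = f a)); [congruence | lra].
Qed.

End TwoRadii.

Section Punctured.

Context {A : BanachAlgebra}.
Context (c : A) (R0 : R)
  (Hpunct : forall mu, 0 < Cmod mu <= R0 -> invertible (shift c mu)).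

Lemma punctured_circle (r : R) : 0 < r <= R0 -> resolvent_circle c r.
Proof. intros Hr; split; [lra|]; intros mu E; apply Hpunct; lra. Qed.

(** Let $s$ increase to $r$ in $p(s)p(r) = p(s)$. *)
Lemma projection_idem (r : R) :
  0 < r <= R0 -> (projection c r * projection c r = projection c r)%A.
Proof.
intros Hr; pose proof (punctured_circle r Hr) as Hcr.
destruct (projection_near c r (proj1 Hr) Hcr) as (d & K & Hd & HK & B).
set (p := projection c r) in *.
apply sub_0_eq, norm_0_eq, Rle_plus_epsilon; intros eps He.
set (L := K * (⟦p⟧ + 1) + 1).
assert (HL : 0 < L).
{ pose proof (norm_nonneg p); assert (0 <= K * (⟦p⟧ + 1)) by (apply Rmult_le_pos; lra).
  unfold L; lra. }
set (h := Rmin (Rmin (r / 2) (d / 2)) (eps / L)).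
assert (Hh : 0 < h) by (repeat apply Rmin_glb_lt; try lra; now apply Rdiv_lt_0_compat).
assert (h1 : h <= r / 2) by (unfold h; eapply Rle_trans; apply Rmin_l).
assert (h2 : h <= d / 2) by (unfold h; eapply Rle_trans; [apply Rmin_l | apply Rmin_r]).
assert (h3 : h <= eps / L) by apply Rmin_r.
assert (Hs : resolvent_circle c (r - h)) by (apply punctured_circle; lra).
pose proof (projection_mul_smaller c (r - h) r ltac:(lra) Hs Hcr) as E; fold p in E.
assert (Hab : Rabs (r - (r - h)) = h) by (rewrite Rabs_pos_eq; lra).
specialize (B (r - h) Hs); rewrite Hab in B; specialize (B ltac:(lra)).
set (q := projection c (r - h)) in *.
replace (p * p - p)%A with ((p - q) * p - (p - q))%A.
2: { transitivity (p * p - q * p - (p - q))%A; [nc_ring | rewrite E; nc_ring]. }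
eapply Rle_trans; [apply norm_sub|].
pose proof (norm_mul_bound (p - q) p _ _ B (Rle_refl _)) as B2.
apply Rle_trans with (h * L); [unfold L; lra|].
rewrite Rplus_0_l; replace eps with (eps / L * L) by (field; lra).
apply Rmult_le_compat_r; lra.
Qed.

(** Two nested circles carry nested idempotents; their difference is an
    idempotent, hence $0$ as soon as its norm is less than $1$. *)
Lemma projection_eq_of_close (s r : R) :
  0 < s < r -> r <= R0 -> ⟦projection c r - projection c s⟧ < 1 ->
  projection c s = projection c r.
Proof.
intros Hs Hr Hn.
assert (Hcs : resolvent_circle c s) by (apply punctured_circle; lra).
assert (Hcr : resolvent_circle c r) by (apply punctured_circle; lra).
pose proof (projection_mul_smaller c s r (proj2 Hs) Hcs Hcr) as E.
pose proof (projection_idem s ltac:(lra)) as Is.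
pose proof (projection_idem r ltac:(lra)) as Ir.
assert (E' : (projection c r * projection c s = projection c s)%A).
{ transitivity (projection c s * projection c r)%A; [|exact E].
  apply projection_commute; [exact Hcs|].
  apply commute_sym, projection_commute; [exact Hcr | reflexivity]. }
symmetry; apply sub_0_eq, norm_small_zero; [exact Hn|].
set (q := projection c s) in *; set (p := projection c r) in *.
replace (p - q)%A with ((p - q) * (p - q))%A at 1; [apply norm_mul|].
transitivity (p * p - p * q - (q * p - q * q))%A; [nc_ring|].
rewrite Is, Ir, E, E'; nc_ring.
Qed.

(** $p(r)$ is locally constant in $r$, hence constant. *)
Lemma projection_radius (s r : R) :
  0 < s <= R0 -> 0 < r <= R0 -> projection c s = projection c r.
Proof.
assert (W : forall s r, 0 < s < r -> r <= R0 -> projection c s = projection c r).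
{ clear s r; intros s r Hs Hr; apply locally_constant_eq; [lra|].
  intros x Hx.
  destruct (projection_near c x ltac:(lra)) as (d & K & Hd & HK & B).
  { apply punctured_circle; lra. }
  exists (Rmin d (/ (K + 1))); split.
  { apply Rmin_glb_lt; [exact Hd | apply Rinv_0_lt_compat; lra]. }
  intros y Hy Hxy; rewrite Rabs_minus_sym in Hxy.
  pose proof (Rlt_le_trans _ _ _ Hxy (Rmin_l _ _)) as H1.
  pose proof (Rlt_le_trans _ _ _ Hxy (Rmin_r _ _)) as H2.
  specialize (B y (punctured_circle y ltac:(lra)) H1).
  assert (H3 : K * Rabs (x - y) < 1).
  { apply (Rmult_lt_compat_l (K + 1)) in H2; [|lra].
    rewrite Rinv_r in H2 by lra; pose proof (Rabs_pos (x - y)); lra. }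
  destruct (Rtotal_order y x) as [L|[->|L]]; [|reflexivity|].
  - apply projection_eq_of_close; lra.
  - symmetry; apply projection_eq_of_close; [lra | lra | rewrite norm_sub_sym; lra]. }
intros Hs Hr; destruct (Rtotal_order s r) as [L|[->|L]]; [|reflexivity|].
- apply W; lra.
- symmetry; apply W; lra.
Qed.

(** On the range of the projection [c] is quasinilpotent, because the circle
    may be shrunk to the puncture. *)
Lemma projection_quasinilpotent (r : R) :
  0 < r <= R0 -> superexp (fun n => c ^ n * projection c r)%A.
Proof.
intros Hr eps He; set (s := Rmin eps r).
assert (Hs : 0 < s <= R0).
{ split; [now apply Rmin_glb_lt|]; eapply Rle_trans; [apply Rmin_r | lra]. }
destruct (pow_mul_projection_bound c s (punctured_circle s Hs)) as (M & HM & B).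
exists (s * M); split; [apply Rmult_le_pos; lra|]; intros n.
rewrite (projection_radius r s Hr Hs).
eapply Rle_trans; [apply B|]; simpl.
replace (s * s ^ n * M) with (s * M * s ^ n) by ring.
apply Rmult_le_compat_l; [apply Rmult_le_pos; lra|].
apply pow_incr; split; [lra | apply Rmin_l].
Qed.

End Punctured.

(** * Quasinilpotent elements and isolated spectral points *)

Section Spectral.

Context {A : BanachAlgebra}.
Implicit Types (a b c p q x y : A).

(** The spectral radius formula in the only case needed: outside the disc of
    radius $\|c\|$ the average is $(1-(c/r)^N)^{-1} 	o 1$, so that the
    projection at every radius is $1$. *)
Lemma quasinilpotent_of_resolvent c :
  (forall mu : C, mu <> 0 -> invertible (shift c mu)) -> superexp (fun n => c ^ n)%A.
Proof.
intros H; set (r := ⟦c⟧ + 1).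
assert (Hr : 0 < r) by (unfold r; pose proof (norm_nonneg c); lra).
assert (Hp : forall mu, 0 < Cmod mu <= r -> invertible (shift c mu)).
{ intros mu Hmu; apply H, Cmod_gt_0; lra. }
pose proof (punctured_circle c r Hp r ltac:(lra)) as Hcr.
destruct (moment_bounded c r Hcr) as (M & HM & B).
assert (E1 : projection c r = 1%A).
{ symmetry; apply (conv_unique (moment c r 1)); [|now apply conv_moment_1].
  apply conv_of_bound with (fun n => ⟦1 : A⟧ * (r * M) * (⟦c⟧ / r) ^ S n).
  - intros n; pose proof (pow_order_mul_moment c r Hcr n) as E.
    specialize (B 1%nat n); simpl in B; rewrite Rmult_1_r in B.
    set (e := moment c r 1 n) in *.
    assert (P : r ^ S n <> 0) by (apply pow_nonzero; lra).
    replace (e - 1)%A with (RtoC (/ r ^ S n) *: (c ^ S n * e))%A.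
    2: { rewrite E, <- scal_sub, scal_scal, <- RtoC_mult, Rinv_l by exact P.
         apply scal_1. }
    eapply Rle_trans; [apply norm_scal_le|].
    rewrite Cmod_R, Rabs_pos_eq by (left; apply Rinv_0_lt_compat, pow_lt, Hr).
    eapply Rle_trans.
    { apply Rmult_le_compat_l; [left; apply Rinv_0_lt_compat, pow_lt, Hr|].
      apply (norm_mul_bound _ _ _ _ (norm_pow c (S n)) B). }
    right; unfold Rdiv; rewrite Rpow_mult_distr, pow_inv; ring.
  - replace 0 with (⟦1 : A⟧ * (r * M) * 0) by ring.
    apply (is_lim_seq_scal_l _ (⟦1 : A⟧ * (r * M)) 0), ratio_pow_lim.
    unfold r; pose proof (norm_nonneg c); lra. }
apply superexp_ext with (fun n => c ^ n * projection c r)%A.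
- intros n; rewrite E1; nc_ring.
- apply projection_quasinilpotent with r; [exact Hp | lra].
Qed.

Definition bicommutant a x : Prop := forall y, commute y a -> commute y x.

(** The algebraic content of the Riesz projection: [p] splits off a part on
    which [c] is quasinilpotent, and [c] is invertible on the complement. *)
Record riesz_splitting c p : Prop := {
  riesz_idem : (p * p = p)%A;
  riesz_bicommutant : bicommutant c p;
  riesz_quasinilpotent : superexp (fun n => c ^ n * p)%A;
  riesz_complement : exists y, bicommutant c y /\ (c * y = 1 - p)%A
}.

Lemma shift_translate a (lambda mu : C) :
  shift a (lambda + mu)%C = shift (a - lambda *: 1)%A mu.
Proof.
change ((lambda + mu)%C *: 1 - a = mu *: 1 - (a - lambda *: 1))%A.
rewrite add_scal; nc_ring.
Qed.

Lemma projection_splitting c (r : R) :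
  0 < r -> (forall mu, 0 < Cmod mu <= r -> invertible (shift c mu)) ->
  riesz_splitting c (projection c r).
Proof.
intros Hr H; pose proof (punctured_circle c r H r ltac:(lra)) as Hcr; split.
- apply projection_idem with r; [exact H | lra].
- intros y Hy; now apply projection_commute.
- apply projection_quasinilpotent with r; [exact H | lra].
- exists (- coprojection c r)%A; split.
  + intros y Hy; pose proof (coprojection_commute c r Hcr y Hy) as E.
    unfold commute in *.
    transitivity (- (y * coprojection c r))%A; [nc_ring | rewrite E; nc_ring].
  + transitivity (- (c * coprojection c r))%A; [nc_ring|].
    rewrite mul_coprojection by exact Hcr; nc_ring.
Qed.

(** The radius chosen in [riesz_proj] is isolating, and the translation of the
    spectral parameter turns the contour into a circle about $0$. *)
Lemma riesz_proj_eq_projection a (lambda : C) :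
  (exists r, isolating_radius a lambda r) ->
  exists r, 0 < r /\
    (forall mu, 0 < Cmod mu <= r -> invertible (shift (a - lambda *: 1)%A mu)) /\
    riesz_proj lambda a = projection (a - lambda *: 1)%A r.
Proof.
intros Hex; pose proof (epsilon_spec (inhabits 1) _ Hex) as Hr.
set (r := epsilon (inhabits 1) (isolating_radius a lambda)) in *.
destruct Hr as [Hr Hiso]; set (c := (a - lambda *: 1)%A).
assert (Hp : forall mu, 0 < Cmod mu <= r -> invertible (shift c mu)).
{ intros mu Hmu; unfold c; rewrite <- shift_translate; apply NNPP; intros Hn.
  assert (E : (lambda + mu)%C = lambda).
  { apply Hiso; [exact Hn|].
    replace (lambda + mu - lambda)%C with mu by ring; lra. }
  assert (mu = 0).
  { replace mu with ((lambda + mu) - lambda)%C by ring; rewrite E; ring. }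
  subst mu; rewrite Cmod_0 in Hmu; lra. }
exists r; split; [exact Hr | split; [exact Hp|]].
pose proof (punctured_circle c r Hp r ltac:(lra)) as Hcr.
assert (Hres : forall mu, resolvent a (lambda + mu)%C = resolvent c mu).
{ intros mu; unfold resolvent; now rewrite shift_translate. }
set (f := fun t => ((Ci * r * expi t)%C *: resolvent a (lambda + r * expi t)%C)%A).
assert (Ef : forall t, f t = (Ci *: (circle r t *: resolvent c (circle r t)))%A).
{ intros t; unfold f; rewrite Hres, scal_scal; f_equal; unfold circle; ring. }
assert (Hf : regular f).
{ apply regular_dominated with (3 := resolvent_circle_regular c r Hcr)
    (K := Cmod Ci * ⟦c⟧).
  - apply Rmult_le_pos; [apply Cmod_ge_0 | apply norm_nonneg].
  - intros s t; rewrite !Ef, <- scal_sub, circle_scal_resolvent_sub by exact Hcr.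
    eapply Rle_trans; [apply norm_scal_le|]; rewrite Rmult_assoc.
    apply Rmult_le_compat_l; [apply Cmod_ge_0 | apply norm_mul]. }
assert (M : mean f = (Ci *: projection c r)%A).
{ apply (conv_unique (average f)); [now apply average_mean|].
  apply conv_ext with (fun n => Ci *: moment c r 1 n)%A.
  - intros n; unfold moment; rewrite <- average_scal; apply average_ext.
    intros k _; now rewrite Ef, Cpow_1_r.
  - now apply conv_scal, conv_moment_1. }
change (((/ (2 * PI * Ci))%C *: integral f 0 (2 * PI))%A = projection c r).
assert (HR : forall x : R, x <> 0 -> RtoC x <> 0).
{ intros x Hx E; apply Hx; exact (f_equal fst E). }
pose proof PI_RGT_0 as HPI.
assert (HCi : Ci <> 0) by (intros E; apply (f_equal Cmod) in E;
  rewrite Cmod_Ci, Cmod_0 in E; lra).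
transitivity ((/ Ci)%C *: mean f)%A.
- unfold mean; rewrite scal_scal; f_equal.
  rewrite RtoC_inv, RtoC_mult by lra.
  field; repeat split; trivial; apply HR; lra.
- rewrite M, scal_scal, Cinv_l by exact HCi; apply scal_1.
Qed.

Lemma isolating_radius_exists a (lambda : C) :
  finite_set (spectrum a) -> exists r, isolating_radius a lambda r.
Proof.
intros [l Hl].
assert (G : exists r, 0 < r /\ forall mu, In mu l -> Cmod (mu - lambda) <= r -> mu = lambda).
{ clear Hl; induction l as [|z l (r & Hr & B)]; [exists 1; split; [lra | intros _ []]|].
  destruct (classic (z = lambda)) as [Ez|Ez].
  - exists r; split; [exact Hr|]; intros mu [<-|Hmu] Hm; auto.
  - assert (Hz : 0 < Cmod (z - lambda)).
    { apply Cmod_gt_0; intros E; apply Ez.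
      replace z with ((z - lambda) + lambda)%C by ring; rewrite E; ring. }
    exists (Rmin r (Cmod (z - lambda) / 2)); split; [apply Rmin_glb_lt; lra|].
    intros mu [<-|Hmu] Hm.
    + pose proof (Rle_trans _ _ _ Hm (Rmin_r _ _)); lra.
    + apply B; [exact Hmu | exact (Rle_trans _ _ _ Hm (Rmin_l _ _))]. }
destruct G as (r & Hr & B); exists r; split; [exact Hr|]; auto.
Qed.

Lemma riesz_proj_splitting a (lambda : C) :
  finite_set (spectrum a) -> riesz_splitting (a - lambda *: 1)%A (riesz_proj lambda a).
Proof.
intros H.
destruct (riesz_proj_eq_projection a lambda) as (r & Hr & Hp & ->).
- now apply isolating_radius_exists.
- now apply projection_splitting.
Qed.

End Spectral.

(** * Decaying commutator iterates force equal spectra *)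

Section SpectrumComparison.

Context {A : BanachAlgebra}.
Implicit Types (a b x y : A).

Lemma invertible_1_sub x : ⟦x⟧ < 1 -> invertible (1 - x)%A.
Proof.
intros Hx.
assert (Hser : ex_series (K := C_AbsRing) (V := A) (fun n => (x ^ n)%A)).
{ apply (ex_series_le (V := A)) with (fun n => ⟦x⟧ ^ n * ⟦1 : A⟧).
  - intros n; apply norm_pow.
  - apply (ex_series_scal_r ⟦1 : A⟧ (fun n => ⟦x⟧ ^ n)), ex_series_geom.
    rewrite Rabs_pos_eq; [exact Hx | apply norm_nonneg]. }
destruct Hser as [s Hs].
assert (Cs : conv (asum (fun n => x ^ n)%A) s).
{ apply is_lim_seq_spec; intros eps.
  pose proof (proj1 (filterlim_locally_ball_norm (U := A) _ _) Hs eps) as [N HN].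
  exists N; intros n Hn; rewrite Rminus_0_r, Rabs_pos_eq by apply norm_nonneg.
  exact (HN n Hn). }
assert (C1 : conv (fun n => 1 - x ^ S n)%A 1).
{ apply conv_of_bound with (fun n => ⟦1 : A⟧ * ⟦x⟧ ^ S n).
  - intros n; replace (1 - x ^ S n - 1)%A with (- x ^ S n)%A by nc_ring.
    rewrite norm_opp_eq, Rmult_comm; apply norm_pow.
  - replace 0 with (⟦1 : A⟧ * 0) by ring.
    apply (is_lim_seq_scal_l _ ⟦1 : A⟧ 0), (is_lim_seq_incr_1 (fun n => ⟦x⟧ ^ n)).
    apply is_lim_seq_geom; rewrite Rabs_pos_eq; [exact Hx | apply norm_nonneg]. }
assert (El : forall n, ((1 - x) * asum (fun n => x ^ n)%A n = 1 - x ^ S n)%A).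
{ induction n as [|n IH]; [rewrite asum_0; simpl; nc_ring|].
  rewrite asum_S.
  transitivity ((1 - x) * asum (fun n => x ^ n)%A n + (1 - x) * x ^ S n)%A; [nc_ring|].
  rewrite IH, (pow_S x (S n)); nc_ring. }
assert (Er : forall n, (asum (fun n => x ^ n)%A n * (1 - x) = 1 - x ^ S n)%A).
{ induction n as [|n IH]; [rewrite asum_0; simpl; nc_ring|].
  rewrite asum_S.
  transitivity (asum (fun n => x ^ n)%A n * (1 - x) + x ^ S n * (1 - x))%A; [nc_ring|].
  rewrite IH, (pow_S_r x (S n)); nc_ring. }
exists s; split.
- apply (conv_unique (fun n => 1 - x ^ S n)%A); [|exact C1].
  apply conv_ext with (1 := El), conv_mul_l, Cs.
- apply (conv_unique (fun n => 1 - x ^ S n)%A); [|exact C1].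
  apply conv_ext with (1 := Er), conv_mul_r, Cs.
Qed.

Lemma iterates_S a b (n : nat) :
  iterates a b (S n) = (a * iterates a b n - iterates a b n * b)%A.
Proof. reflexivity. Qed.

(** The partial sums of
    $(\mu-b)^{-1} = \sum_n (-1)^n(\mu-a)^{-n-1}C_{a,b}^n1$ are left inverses
    of $\mu-b$ up to an error that tends to $0$. *)
Lemma shift_left_inverse a b (mu : C) :
  superexp (iterates a b) -> invertible (shift a mu) ->
  exists y, (y * shift b mu = 1)%A.
Proof.
intros Hx Ha; pose proof (resolvent_r a mu Ha) as Er.
set (r := resolvent a mu) in *; set (x := iterates a b) in *.
assert (G : forall n, exists s, (s * (mu *: 1 - b) = 1 - (- r) ^ n * x n)%A).
{ induction n as [|n [s Hs]]; [exists 0%A; unfold x; simpl; nc_ring|].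
  exists (s - (- r) ^ S n * x n)%A.
  transitivity (s * (mu *: 1 - b) - (- r) ^ S n * (x n * (mu *: 1 - b)))%A; [nc_ring|].
  replace (x n * (mu *: 1 - b))%A with (x (S n) + (mu *: 1 - a) * x n)%A.
  2: { unfold x; rewrite iterates_S; fold x.
       assert (E : (x n * (mu *: 1) = (mu *: 1) * x n)%A).
       { rewrite scal_mul_l, scal_mul_r; f_equal; nc_ring. }
       transitivity (x n * (mu *: 1) - x n * b)%A; [rewrite E; nc_ring | nc_ring]. }
  rewrite Hs, pow_S_r.
  assert (E : (r * (mu *: 1 - a) = 1)%A).
  { transitivity (r * (mu *: 1) - r * a)%A; [nc_ring|].
    rewrite Er, scal_mul_r, mul_1_r; nc_ring. }
  transitivity (1 - (- r) ^ n * x n - ((- r) ^ n * - r * x (S n))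
                + (- r) ^ n * (r * (mu *: 1 - a)) * x n)%A; [nc_ring|].
  rewrite E; nc_ring. }
destruct (superexp_small x (- r)%A Hx) as [n Hn]; destruct (G n) as [s Hs].
destruct (invertible_1_sub ((- r) ^ n * x n)%A) as [z [_ Hz]].
{ eapply Rle_lt_trans; [apply norm_mul | now rewrite Rmult_comm]. }
exists (z * s)%A.
change ((z * s * (mu *: 1 - b))%A = 1%A); rewrite <- mul_assoc, Hs; exact Hz.
Qed.

(** The mirror image: $y_n = C_{b,a}^n1$ satisfies
    $(\mu-b)y_n = y_n(\mu-a) - y_{n+1}$, and $\sum_n y_n(\mu-a)^{-n-1}$
    telescopes. *)
Lemma shift_right_inverse a b (mu : C) :
  superexp (iterates b a) -> invertible (shift a mu) ->
  exists y, (shift b mu * y = 1)%A.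
Proof.
intros Hx Ha; pose proof (resolvent_l a mu Ha) as El.
set (r := resolvent a mu) in *; set (x := iterates b a) in *.
assert (G : forall n, exists s, ((mu *: 1 - b) * s = 1 - x n * r ^ n)%A).
{ induction n as [|n [s Hs]]; [exists 0%A; unfold x; simpl; nc_ring|].
  exists (s + x n * r ^ S n)%A.
  transitivity ((mu *: 1 - b) * s + ((mu *: 1 - b) * x n) * r ^ S n)%A; [nc_ring|].
  replace ((mu *: 1 - b) * x n)%A with (x n * (mu *: 1 - a) - x (S n))%A.
  2: { unfold x; rewrite iterates_S; fold x.
       assert (E : (x n * (mu *: 1) = (mu *: 1) * x n)%A).
       { rewrite scal_mul_l, scal_mul_r; f_equal; nc_ring. }
       transitivity (x n * (mu *: 1) - b * x n)%A; [nc_ring | rewrite E; nc_ring]. }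
  rewrite Hs, pow_S.
  assert (E : ((mu *: 1 - a) * r = 1)%A).
  { transitivity ((mu *: 1) * r - a * r)%A; [nc_ring|].
    rewrite El, scal_mul_l, mul_1_l; nc_ring. }
  transitivity (1 - x n * r ^ n + x n * ((mu *: 1 - a) * r) * r ^ n
                - x (S n) * (r * r ^ n))%A; [nc_ring|].
  rewrite E; nc_ring. }
destruct (superexp_small x r Hx) as [n Hn]; destruct (G n) as [s Hs].
destruct (invertible_1_sub (x n * r ^ n)%A) as [z [Hz _]].
{ eapply Rle_lt_trans; [apply norm_mul | exact Hn]. }
exists (s * z)%A.
change (((mu *: 1 - b) * (s * z))%A = 1%A); rewrite mul_assoc, Hs; exact Hz.
Qed.

Lemma spectrum_incl a b (mu : C) :
  superexp (iterates a b) -> superexp (iterates b a) -> spectrum b mu -> spectrum a mu.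
Proof.
intros Hab Hba Hb Ha; apply Hb.
destruct (shift_left_inverse a b mu Hab Ha) as [y Hy].
destruct (shift_right_inverse a b mu Hba Ha) as [z Hz].
assert (E : y = z).
{ transitivity (y * (shift b mu * z))%A; [rewrite Hz; nc_ring|].
  rewrite mul_assoc, Hy; nc_ring. }
exists y; split; [rewrite E; exact Hz | exact Hy].
Qed.

End SpectrumComparison.

(** * Decaying commutator iterates force equal Riesz projections *)

Section ProjectionComparison.

Context {A : BanachAlgebra}.
Implicit Types (a b c d p q x y : A).

Lemma iterates_translate a b (k : C) (n : nat) :
  iterates (a - k *: 1)%A (b - k *: 1)%A n = iterates a b n.
Proof.
induction n as [|n IH]; [reflexivity|].
rewrite !iterates_S, IH; set (x := iterates a b n).
assert (E : (x * (k *: 1) = (k *: 1) * x)%A).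
{ rewrite scal_mul_l, scal_mul_r; f_equal; nc_ring. }
transitivity (a * x - x * b - ((k *: 1) * x - x * (k *: 1)))%A; [nc_ring|].
rewrite E; nc_ring.
Qed.

Lemma norm_add_of_eq x y z : x = (y + z)%A -> ⟦x⟧ <= ⟦y⟧ + ⟦z⟧.
Proof. intros ->; apply norm_add. Qed.

Lemma norm_sub_of_eq x y z : x = (y - z)%A -> ⟦x⟧ <= ⟦y⟧ + ⟦z⟧.
Proof. intros ->; apply norm_sub. Qed.

Lemma norm_mul_two_scale x y (K L eps : R) (i j : nat) :
  ⟦x⟧ <= K * eps ^ i -> ⟦y⟧ <= L * eps ^ j -> ⟦x * y⟧ <= K * L * eps ^ (i + j).
Proof.
intros Hx Hy; rewrite pow_add.
replace (K * L * (eps ^ i * eps ^ j)) with (K * eps ^ i * (L * eps ^ j)) by ring.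
now apply norm_mul_bound.
Qed.

(** $c^n q = \sum_k \binom nk C_{c,d}^{n-k}(1)\, d^k q$. *)
Lemma superexp_pow_left c d q :
  superexp (iterates c d) -> superexp (fun n => d ^ n * q)%A ->
  superexp (fun n => c ^ n * q)%A.
Proof.
intros Hx Hq; set (x := iterates c d) in *.
apply superexp_ext with (fun n => c ^ n * (x O * (d ^ O * q)))%A.
{ intros n; unfold x; simpl; nc_ring. }
apply (superexp_binomial (fun n i j => c ^ n * (x i * (d ^ j * q)))%A).
- intros eps He.
  destruct (Hx eps He) as (K & HK & B); destruct (Hq eps He) as (L & HL & D).
  exists (K * L); split; [now apply Rmult_le_pos|]; intros i j.
  replace (c ^ 0 * (x i * (d ^ j * q)))%A with (x i * (d ^ j * q))%A by (simpl; nc_ring).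
  now apply norm_mul_two_scale.
- intros n i j; apply norm_add_of_eq.
  unfold x; rewrite iterates_S, pow_S_r, (pow_S d j); nc_ring.
Qed.

(** $p d^n = \sum_k \binom nk (-1)^{n-k} p c^k\, C_{c,d}^{n-k}(1)$. *)
Lemma superexp_pow_right c d p :
  superexp (iterates c d) -> superexp (fun n => p * c ^ n)%A ->
  superexp (fun n => p * d ^ n)%A.
Proof.
intros Hx Hp; set (x := iterates c d) in *.
apply superexp_ext with (fun n => p * c ^ O * x O * d ^ n)%A.
{ intros n; unfold x; simpl; nc_ring. }
apply (superexp_binomial (fun n i j => p * c ^ i * x j * d ^ n)%A).
- intros eps He.
  destruct (Hx eps He) as (K & HK & B); destruct (Hp eps He) as (L & HL & D).
  exists (L * K); split; [now apply Rmult_le_pos|]; intros i j.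
  replace (p * c ^ i * x j * d ^ 0)%A with (p * c ^ i * x j)%A by (simpl; nc_ring).
  now apply norm_mul_two_scale.
- intros n i j; apply norm_sub_of_eq.
  unfold x; rewrite iterates_S, (pow_S_r c i), (pow_S d n); nc_ring.
Qed.

Lemma compl_idem p : (p * p = p)%A -> ((1 - p) * (1 - p) = 1 - p)%A.
Proof.
intros H; transitivity (1 - p - p + p * p)%A; [nc_ring | rewrite H; nc_ring].
Qed.

(** A vector on which [c] acts quasinilpotently has no component on the
    complement, where [c] is invertible. *)
Lemma splitting_absorbs_left c p q :
  riesz_splitting c p -> superexp (fun n => c ^ n * q)%A -> (p * q = q)%A.
Proof.
intros [Ip Bp _ (y & By & Ey)] Hq.
assert (Cyc : commute y c) by (apply commute_sym, By; reflexivity).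
assert (Hz : ((1 - p) * q)%A = 0%A).
{ apply superexp_pow_l_zero with (fun n => (1 - p) * (c ^ n * q))%A y.
  - now apply superexp_mul_l.
  - intros n; pose proof (pow_idem (1 - p) n (compl_idem p Ip)) as E.
    rewrite pow_S in E; rewrite <- Ey in E at 2.
    rewrite <- Cyc, pow_mul in E by exact Cyc.
    assert (C1 : commute (1 - p)%A (y ^ n)%A).
    { apply commute_pow; rewrite <- Ey; apply commute_sym, commute_mul; [exact Cyc | reflexivity]. }
    transitivity ((1 - p) * y ^ n * c ^ n * q)%A; [|rewrite C1; nc_ring].
    rewrite <- E at 1; nc_ring. }
symmetry; apply sub_0_eq; rewrite <- Hz; nc_ring.
Qed.

Lemma splitting_absorbs_right d p q :
  riesz_splitting d q -> superexp (fun n => p * d ^ n)%A -> (p * q = p)%A.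
Proof.
intros [Iq Bq _ (y & By & Ey)] Hp.
assert (Cyd : commute d y) by (apply By; reflexivity).
assert (Hz : (p * (1 - q))%A = 0%A).
{ apply superexp_pow_r_zero with (fun n => p * d ^ n * (1 - q))%A y.
  - now apply superexp_mul_r.
  - intros n; pose proof (pow_idem (1 - q) n (compl_idem q Iq)) as E.
    rewrite pow_S_r in E; rewrite <- Ey in E at 1.
    rewrite pow_mul in E by exact Cyd.
    assert (C1 : commute (1 - q)%A (y ^ n)%A).
    { apply commute_pow; rewrite <- Ey.
      apply commute_sym, commute_mul; [now apply commute_sym | reflexivity]. }
    transitivity (p * d ^ n * ((1 - q) * y ^ n))%A; [|nc_ring].
    rewrite C1; rewrite <- E at 1; nc_ring. }
symmetry; apply sub_0_eq; rewrite <- Hz; nc_ring.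
Qed.

(** $p = pq$ and $pq = q$: each equation carries the quasinilpotence from one of
    [c], [d] to the other, from the right and from the left respectively. *)
Lemma splitting_unique c d p q :
  superexp (iterates c d) -> riesz_splitting c p -> riesz_splitting d q -> p = q.
Proof.
intros Hx Hp Hq; transitivity (p * q)%A.
- symmetry; apply splitting_absorbs_right with d; [exact Hq|].
  apply superexp_pow_right with c; [exact Hx|].
  apply superexp_ext with (2 := riesz_quasinilpotent _ _ Hp); intros n.
  apply commute_sym, commute_pow, commute_sym, (riesz_bicommutant _ _ Hp); reflexivity.
- apply splitting_absorbs_left with c; [exact Hp|].
  apply superexp_pow_left with d; [exact Hx | apply riesz_quasinilpotent, Hq].
Qed.

End ProjectionComparison.

(** * Common Riesz projections make the commutator iterates decay *)

Section Converse.

Context {A : BanachAlgebra}.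
Implicit Types (a b c d p q x y : A).

(** $C_{c,d}^n(p) = \sum_k\binom nk(-1)^{k}\,c^{n-k}p\cdot d^kp$, since [p] is
    idempotent and commutes with [c] and [d]. *)
Lemma superexp_on_projection c d p :
  riesz_splitting c p -> riesz_splitting d p ->
  superexp (fun n => iterates c d n * p)%A.
Proof.
intros Hc Hd; set (x := iterates c d).
apply superexp_ext with (fun n => c ^ O * x n * d ^ O * p)%A.
{ intros n; simpl; nc_ring. }
apply (superexp_binomial (fun n i j => c ^ i * x n * d ^ j * p)%A).
- intros eps He.
  destruct (riesz_quasinilpotent _ _ Hc eps He) as (K & HK & B).
  destruct (riesz_quasinilpotent _ _ Hd eps He) as (L & HL & D).
  exists (K * L); split; [now apply Rmult_le_pos|]; intros i j.
  replace (c ^ i * x O * d ^ j * p)%A with ((c ^ i * p) * (d ^ j * p))%A.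
  + now apply norm_mul_two_scale.
  + assert (E : (p * d ^ j = d ^ j * p)%A).
    { apply commute_pow, commute_sym, (riesz_bicommutant _ _ Hd); reflexivity. }
    transitivity (c ^ i * (p * d ^ j) * p)%A; [nc_ring|]; rewrite E.
    transitivity (c ^ i * d ^ j * (p * p))%A; [nc_ring|].
    rewrite (riesz_idem _ _ Hc); unfold x; simpl; nc_ring.
- intros n i j; apply norm_sub_of_eq.
  unfold x; rewrite iterates_S, pow_S_r, (pow_S d j); nc_ring.
Qed.

Lemma commute_translate y a (k : C) : commute y a -> commute y (a - k *: 1)%A.
Proof. intros H; apply commute_sub; [exact H | apply commute_scal, commute_1]. Qed.

Lemma bicommutant_translate a x (k : C) : bicommutant (a - k *: 1)%A x -> bicommutant a x.
Proof. intros H y Hy; now apply H, commute_translate. Qed.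

Lemma bicommutant_mul a x y : bicommutant a x -> bicommutant a y -> bicommutant a (x * y)%A.
Proof. intros Hx Hy z Hz; apply commute_mul; auto. Qed.

Lemma bicommutant_sub a x y : bicommutant a x -> bicommutant a y -> bicommutant a (x - y)%A.
Proof. intros Hx Hy z Hz; apply commute_sub; auto. Qed.

Lemma bicommutant_1 a : bicommutant a 1%A.
Proof. intros z _; apply commute_1. Qed.

Lemma bicommutant_commute a x y : bicommutant a x -> bicommutant a y -> commute x y.
Proof. intros Hx Hy; apply Hy, commute_sym, Hx; reflexivity. Qed.

(** The element $aq$ has no spectrum outside $0$, so it is quasinilpotent; but it
    is invertible on the range of $q$, which must therefore be trivial. *)
Lemma idem_without_spectrum_zero a q :
  (q * q = q)%A -> bicommutant a q ->
  (forall mu, exists y, bicommutant a y /\ ((a - mu *: 1) * y = q)%A) -> q = 0%A.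
Proof.
intros Iq Bq H.
assert (Caq : commute a q) by (apply Bq; reflexivity).
assert (Hquasi : superexp (fun n => (a * q) ^ n)%A).
{ apply quasinilpotent_of_resolvent; intros mu Hmu.
  destruct (H mu) as (y & By & Ey).
  set (z := ((/ mu)%C *: (1 - q) - y * q)%A).
  assert (Cyq : commute y q) by now apply bicommutant_commute with a.
  assert (Cqa : commute q (a * q)%A).
  { apply commute_mul; [apply commute_sym, Caq | reflexivity]. }
  assert (Cya : commute y (a * q)%A).
  { apply commute_mul; [apply commute_sym, By; reflexivity | exact Cyq]. }
  assert (Caz : commute (mu *: 1 - a * q)%A z).
  { apply commute_sym, commute_sub; [apply commute_scal, commute_1|].
    apply commute_sym; unfold z; apply commute_sub.
    - apply commute_scal, commute_sub; [apply commute_1 | now apply commute_sym].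
    - apply commute_mul; now apply commute_sym. }
  assert (E : ((mu *: 1 - a * q) * z = 1)%A).
  { unfold z.
    transitivity ((mu *: 1 - a * q) * ((/ mu)%C *: (1 - q))
                  + (a * q * y - (mu *: 1) * y) * q)%A; [nc_ring|].
    replace ((mu *: 1 - a * q) * ((/ mu)%C *: (1 - q)))%A with (1 - q)%A.
    - replace ((a * q * y - (mu *: 1) * y) * q)%A with ((a - mu *: 1) * y * q)%A.
      + rewrite Ey, Iq; nc_ring.
      + unfold commute in Cyq.
        transitivity (a * (y * (q * q)) - (mu *: 1) * y * q)%A; [rewrite Iq; nc_ring|].
        transitivity (a * (y * q) * q - (mu *: 1) * y * q)%A; [nc_ring|].
        rewrite Cyq; nc_ring.
    - rewrite scal_mul_r.
      replace ((mu *: 1 - a * q) * (1 - q))%A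
        with ((mu *: 1) * (1 - q) - a * (q - q * q))%A by nc_ring.
      rewrite Iq, scal_mul_l.
      replace (mu *: (1 * (1 - q)) - a * (q - q))%A with (mu *: (1 - q))%A.
      + rewrite scal_scal, Cinv_l by exact Hmu; symmetry; apply scal_1.
      + replace (1 * (1 - q))%A with (1 - q)%A by nc_ring; nc_ring. }
  exists z; split; [exact E | exact (eq_trans (eq_sym Caz) E)]. }
destruct (H (RtoC 0)) as (y & By & Ey).
assert (Ey' : (a * y = q)%A).
{ rewrite <- Ey; replace (RtoC 0 *: (1 : A))%A with (0 : A)%A; [nc_ring|].
  symmetry; exact (@scal_zero_l C_AbsRing A one). }
assert (Cyq : commute y q) by now apply bicommutant_commute with a.
assert (Cya : commute (a * q)%A y).
{ apply commute_sym, commute_mul; [apply commute_sym, By; reflexivity | exact Cyq]. }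
apply superexp_pow_r_zero with (fun n => (a * q) ^ n * q)%A y.
- now apply superexp_mul_r.
- intros n; pose proof (pow_mul (a * q) y n Cya) as E.
  replace (a * q * y)%A with q in E.
  2: { rewrite <- mul_assoc, <- Cyq, mul_assoc, Ey'; now symmetry. }
  assert (C1 : commute q (y ^ n)%A) by (apply commute_pow, commute_sym, Cyq).
  rewrite <- (pow_idem q n Iq), pow_S_r, E at 1.
  rewrite <- !mul_assoc; f_equal; symmetry; exact C1.
Qed.

(** $q = \prod_{\lambda}(1-p_\lambda)$, built one spectral point at a time. *)
Lemma complementary_idempotent a (u : nat -> A) (l : list C) :
  finite_set (spectrum a) ->
  (forall z, spectrum a z -> superexp (fun n => u n * riesz_proj z a)%A) ->
  exists q, (q * q = q)%A /\ bicommutant a q /\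
    (forall z, In z l -> spectrum a z ->
       exists y, bicommutant a y /\ ((a - z *: 1) * y = q)%A) /\
    superexp (fun n => u n - u n * q)%A.
Proof.
intros Hfin Hu; induction l as [|z l (q & Iq & Bq & Hl & Hs)].
- exists 1%A; split; [nc_ring|]; split; [apply bicommutant_1|]; split; [intros _ []|].
  apply superexp_ext with (fun _ => 0%A); [intros n; nc_ring | apply superexp_zero].
- destruct (classic (spectrum a z)) as [Hz|Hz].
  2: { exists q; split; [exact Iq|]; split; [exact Bq|]; split; [|exact Hs].
       intros w [<-|Hw] Hsp; [contradiction | now apply Hl]. }
  pose proof (riesz_proj_splitting a z Hfin) as [Ip Bp0 _ (y & By0 & Ey)].
  specialize (Hu z Hz); set (p := riesz_proj z a) in *.
  pose proof (bicommutant_translate _ _ _ Bp0) as Bp.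
  pose proof (bicommutant_translate _ _ _ By0) as By.
  assert (Cqp : commute q p) by now apply bicommutant_commute with a.
  unfold commute in Cqp.
  exists (q * (1 - p))%A; split; [|split; [|split]].
  + transitivity (q * q * (1 - p) - q * (p * q) * (1 - p))%A; [nc_ring|].
    rewrite <- Cqp.
    transitivity (q * q * (1 - p) - q * q * (p - p * p))%A; [nc_ring|].
    rewrite Iq, Ip; nc_ring.
  + apply bicommutant_mul; [exact Bq | apply bicommutant_sub; [apply bicommutant_1 | exact Bp]].
  + intros w [<-|Hw] Hsp.
    * exists (y * q)%A; split; [now apply bicommutant_mul|].
      rewrite mul_assoc, Ey.
      transitivity (q - p * q)%A; [nc_ring | rewrite <- Cqp; nc_ring].
    * destruct (Hl w Hw Hsp) as (v & Bv & Ev); exists (v * (1 - p))%A; split.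
      -- apply bicommutant_mul; [exact Bv | apply bicommutant_sub; [apply bicommutant_1 | exact Bp]].
      -- now rewrite mul_assoc, Ev.
  + apply superexp_ext with (fun n => (u n - u n * q) + u n * p * q)%A.
    * intros n; transitivity (u n - u n * q + u n * (p * q))%A; [nc_ring|].
      rewrite <- Cqp; nc_ring.
    * apply superexp_plus; [exact Hs | now apply superexp_mul_r].
Qed.

(** Stated for an arbitrary sequence because it is applied to the iterates of
    $C_{a,b}$ and of $C_{b,a}$, both times with the projections of [a]. *)
Lemma superexp_of_projections a (u : nat -> A) :
  finite_set (spectrum a) ->
  (forall z, spectrum a z -> superexp (fun n => u n * riesz_proj z a)%A) ->
  superexp u.
Proof.
intros Hfin Hu; pose proof Hfin as [l Hl].
destruct (complementary_idempotent a u l Hfin Hu) as (q & Iq & Bq & Hy & Hs).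
assert (Hq : q = 0%A).
{ apply idem_without_spectrum_zero with a; trivial; intros mu.
  destruct (classic (spectrum a mu)) as [Hmu|Hmu]; [apply Hy; auto|].
  assert (Hinv : invertible (shift a mu)) by now apply NNPP.
  exists (- resolvent a mu * q)%A; split.
  - apply bicommutant_mul; [|exact Bq]; intros z Hz.
    pose proof (resolvent_commute a mu z Hinv Hz) as E; unfold commute in *.
    transitivity (- (z * resolvent a mu))%A; [nc_ring | rewrite E; nc_ring].
  - transitivity (((mu *: 1) * resolvent a mu - a * resolvent a mu) * q)%A; [nc_ring|].
    rewrite resolvent_l, scal_mul_l, mul_1_l by exact Hinv; nc_ring. }
apply superexp_ext with (2 := Hs); intros n; rewrite Hq; nc_ring.
Qed.

End Converse.

Lemma qdist_zero_iff {A : BanachAlgebra} (a b : A) :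
  qdist a b = Finite 0 <-> superexp (iterates a b) /\ superexp (iterates b a).
Proof.
rewrite <- !rho_zero_iff; unfold qdist, Rbar_max.
pose proof (rho_nonneg a b) as H1; pose proof (rho_nonneg b a) as H2.
destruct (Rbar_le_dec (rho a b) (rho b a)) as [L|L]; split.
- intros E; split; [|exact E]; apply Rbar_le_antisym; [now rewrite <- E | exact H1].
- now intros [_ E].
- intros E; split; [exact E|]; apply Rbar_le_antisym; [|exact H2].
  rewrite <- E; now apply Rbar_lt_le, Rbar_not_le_lt.
- now intros [E _].
Qed.

Theorem theorem4p2 (A : BanachAlgebra) (a b : A) (hfin : finite_set (spectrum a)) :
  qdist a b = Finite 0 <->
  ((forall lambda : C, spectrum a lambda <-> spectrum b lambda) /\
   (forall lambda : C, spectrum a lambda ->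
      riesz_proj lambda a = riesz_proj lambda b)).
Proof.
assert (Hb : (forall z, spectrum a z <-> spectrum b z) -> finite_set (spectrum b)).
{ intros E; destruct hfin as [l Hl]; exists l; intros z Hz; now apply Hl, E. }
rewrite qdist_zero_iff; split.
- intros [Hab Hba].
  assert (E : forall z, spectrum a z <-> spectrum b z).
  { intros z; split; now apply spectrum_incl. }
  split; [exact E|]; intros z _.
  apply splitting_unique with (a - z *: 1)%A (b - z *: 1)%A.
  + apply superexp_ext with (2 := Hab); intros n; now rewrite iterates_translate.
  + now apply riesz_proj_splitting.
  + now apply riesz_proj_splitting, Hb.
- intros [E Hp].
  assert (G : forall z, spectrum a z ->
    riesz_splitting (a - z *: 1)%A (riesz_proj z a) /\
    riesz_splitting (b - z *: 1)%A (riesz_proj z a)).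
  { intros z Hz; split; [now apply riesz_proj_splitting|].
    rewrite Hp by exact Hz; now apply riesz_proj_splitting, Hb. }
  split; apply (superexp_of_projections a); trivial; intros z Hz;
    destruct (G z Hz) as [Ga Gb].
  + apply superexp_ext with (2 := superexp_on_projection _ _ _ Ga Gb).
    intros n; now rewrite iterates_translate.
  + apply superexp_ext with (2 := superexp_on_projection _ _ _ Gb Ga).
    intros n; now rewrite iterates_translate.
Qed.
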